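(* Let $p$ be an odd prime, $s\mid k$, $q=p^k$, $r=p^s$, $V_n=\mathbb{F}_{p^n}$ with the trace form $\langle b,x\rangle=\mathrm{Tr}^n_1(bx)$, and let $H\colon\mathbb{F}_{p^n}\times\mathbb{F}_q\times\mathbb{F}_q\to\mathbb{F}_r$, $H(x,y,z)=P^{(z)}(x)+\mathrm{Tr}^k_s(yz)$, with one of the following choices. (a) $n=2m$ with $s\mid m$, and either $p\equiv1\bmod4$, or $p\equiv3\bmod4$ and $n\equiv0\bmod4$; $P^{(0)}(x)=\mathrm{Tr}^n_s(x^2)$, and for $z\ne0$, $P^{(z)}(x_1,x_2)=\mathrm{Tr}^m_s(x_1x_2)$, where $\mathbb{F}_{p^n}$ is identified with $\mathbb{F}_{p^m}\times\mathbb{F}_{p^m}$ by an $\mathbb{F}_{p^m}$-basis. (b) $n$ even, $s\mid n$ with $n/s$ odd and $n/s\ge3$, and $\nu$ a nonsquare in $\mathbb{F}_r$; $P^{(0)}(x)=\mathrm{Tr}^n_s(x^2)$ and $P^{(z)}(x)=\mathrm{Tr}^n_s(\nu x^2)$ for $z\ne0$. Then all $r-1$ components $H_t$, $t\in\mathbb{F}_r^*$, of $H$ are non-weakly regular bent, $H$ is vectorial dual-bent, and the partition $\Omega_s(H)$ induces a symmetric association scheme with $\frac{q-1}{r-1}(r+1)+r-1+\delta$ classes, where $\delta=0$ in case (a) with $n=2s$, and $\delta=1$ otherwise. Moreover, for every $\mathbb{F}_r$-subspace $K_0$ of $\mathbb{F}_q$, the partition $\Omega(H,K_0)$ induces a symmetric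 association scheme with $2r+\delta$ classes if $K_0\in\{\{0\},\mathbb{F}_q\}$ and $3r+1+\delta$ classes otherwise. All these schemes have fusion schemes at every level $s'\mid s$: for every $s'\mid s$, $r'=p^{s'}$, $\gamma\in\mathbb{F}_r^*$ and every $\mathbb{F}_r$-subspace $K_0$ of $\mathbb{F}_q$, the partition $\Omega(\mathrm{Tr}^s_{s'}(\gamma H),K_0)$ is Fourier-reflexive and induces a fusion scheme of the scheme induced by $\Omega(H,K_0)$, with $2r'+\delta'$ classes if $K_0\in\{\{0\},\mathbb{F}_q\}$ and $3r'+1+\delta'$ classes otherwise, where $\delta'=\delta$ if $s'=s$ and $\delta'=1$ if $s'<s$; and for $\gamma_1,\gamma_2\in\mathbb{F}_r^*$ in different cosets of $\mathbb{F}_{r'}^*$ the partitions $\Omega(\mathrm{Tr}^s_{s'}(\gamma_1H),K_0)$ and $\Omega(\mathrm{Tr}^s_{s'}(\gamma_2H),K_0)$ are different.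
   Context: Notation: $\mathrm{Tr}^a_b$ is the trace $\mathbb{F}_{p^a}\to\mathbb{F}_{p^b}$ ($b\mid a$); $\zeta_p=e^{2\pi i/p}$. For an $\mathbb{F}_p$-space $W$ of even dimension $N$ with nondegenerate symmetric bilinear form $\langle\cdot,\cdot\rangle$ and $f\colon W\to\mathbb{F}_p$, the Walsh transform is $W_f(b)=\sum_{x\in W}\zeta_p^{f(x)-\langle b,x\rangle}$. $f$ is bent if $|W_f(b)|=p^{N/2}$ for all $b$; then (as $N$ is even) $W_f(b)=\varepsilon_f(b)p^{N/2}\zeta_p^{f^*(b)}$ with $\varepsilon_f(b)\in\{\pm1\}$ and a function $f^*\colon W\to\mathbb{F}_p$, the dual of $f$. A bent $f$ is weakly regular if $\varepsilon_f$ is constant, and non-weakly regular otherwise. For $F\colon W\to\mathbb{F}_r$ and $t\in\mathbb{F}_r^*$ the component is $F_t=\mathrm{Tr}^s_1(tF)$; $F$ is vectorial bent if all $F_t$, $t\neq0$, are bent, and vectorial dual-bent if it is vectorial bent and there are a vectorial bent $F^*\colon W\to\mathbb{F}_r$ and a permutation $\sigma$ of $\mathbb{F}_r^*$ with $(F_t)^*=(F^* )_{\sigma(t)}$ for all $t\in\mathbb{F}_r^*$. $V=V_n\times\mathbb{F}_q\times\mathbb{F}_q$ carries the form $\langle(u,v,w),(x,y,z)\rangle=\langle u,x\rangle+\mathrm{Tr}^k_1(vy)+\mathrm{Tr}^k_1(wz)$. Partition $\Omega_s(H)$: let $\mathcal{L}$ be the set of one-dimensional $\mathbb{F}_r$-subspaces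 of $\mathbb{F}_q$. Put $c_{L,i}=\{(x,y,z): z\in L\setminus\{0\}, H(x,y,z)=i\}$, $B_L=\{(0,y,0): y\in L\setminus\{0\}\}$, $e_i=\{(x,y,0): x\ne0, P^{(0)}(x)=i\}$. Then $\Omega_s(H)=\{\{0\},e_i,c_{L,i},B_L\ (L\in\mathcal{L},i\in\mathbb{F}_r)\}$ with $e_0$ omitted if empty. Partition $\Omega(H,K_0)$: let $K_0^\perp=\{y\in\mathbb{F}_q:\mathrm{Tr}^k_1(zy)=0\ \forall z\in K_0\}$, $B_1=\{(0,y,0): y\in K_0^\perp\setminus\{0\}\}$, $B_2=\{(0,y,0): y\in\mathbb{F}_q\setminus K_0^\perp\}$, $c_i=\{(x,y,z): z\notin K_0, H(x,y,z)=i\}$, $d_i=\{(x,y,z): z\in K_0\setminus\{0\}, H(x,y,z)=i\}$. Then $\Omega(H,K_0)=\{\{0\},B_1,B_2,e_i,d_i,c_i\ (i\in\mathbb{F}_r)\}$ with empty cells omitted. For $H'=\mathrm{Tr}^s_{s'}(\gamma H)\colon V\to\mathbb{F}_{r'}$, $\Omega(H',K_0)$ is defined in the same way with $j\in\mathbb{F}_{r'}$: cells $\{0\}$, $B_1$, $B_2$, $c'_j=\{z\notin K_0, H'=j\}$, $d'_j=\{z\in K_0\setminus\{0\}, H'=j\}$, $e'_j=\{(x,y,0): x\ne0, \mathrm{Tr}^s_{s'}(\gamma P^{(0)}(x))=j\}$, empty cells omitted. Fourier-reflexivity: for $\xi\in V$ and $S\subseteq V$ let $\chi_\xi(S)=\sum_{s\in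 S}\zeta_p^{-\langle\xi,s\rangle}$. The dual partition $\widehat\Omega$ of a partition $\Omega=\{\{0\},U_1,\dots,U_d\}$ of $V$ (with $U_0=\{0\}$) is the partition of $V$ into the level sets of $\xi\mapsto(\chi_\xi(U_0),\dots,\chi_\xi(U_d))$; $\Omega$ is Fourier-reflexive if $|\widehat\Omega|=|\Omega|$. $\Omega$ induces an association scheme if the relations $R_0=\{(x,x)\}$, $R_i=\{(x,y): y-x\in U_i\}$ form a ($d$-class) association scheme on $V$. A fusion scheme of a scheme is an association scheme each of whose relations is a union of relations of the given one. *)

(* Defs.v *)
From HB Require Import structures.
From mathcomp Require Import all_boot all_order all_algebra all_fingroup all_solvable all_field.

Set Implicit Arguments.
Unset Strict Implicit.
Unset Printing Implicit Defensive.

Import GRing.Theory Num.Theory.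
Local Open Scope ring_scope.

HB.instance Definition _ (A B : finZmodType) := GRing.Zmodule.on (A * B)%type.

(* An extension E / F of finite fields is given by an embedding iota : F -> E.
   Then #|E| = #|F| ^ d, where d = trunc_log #|F| #|E| is the degree, and the
   trace is the element of F whose image in E is the sum of the conjugates
   x ^ (#|F| ^ i), i < d. The default value 0 is never used (lemma trP). *)
Definition tr (F E : finFieldType) (iota : F -> E) (x : E) : F :=
  odflt 0 [pick y | iota y == \sum_(i < trunc_log #|F| #|E|) x ^+ (#|F| ^ i)].

Lemma trP (F E : finFieldType) (iota : {rmorphism F -> E}) (d : nat) (x : E) :
  #|E| = (#|F| ^ d)%N -> iota (tr iota x) = \sum_(i < d) x ^+ (#|F| ^ i).
Proof.
move=> cardE.
have F_gt1 : (1 < #|F|)%N := finNzRing_gt1 F.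
have F_nat : [pchar E].-nat #|F|.
  have [r _ rF] := finPcharP F.
  have rE : r \in [pchar E] by rewrite (fmorph_pchar iota).
  rewrite (eq_pnat _ (pcharf_eq rE)) -cardsT.
  exact: abelem_pgroup (fin_ring_pchar_abelem rF).
rewrite /tr cardE trunc_expnK //; set S := \sum_(i < d) _.
have S_fix : S ^+ #|F| = S.
  have d_gt0 : (0 < d)%N.
    by case: d cardE {S} => // E1; have := finNzRing_gt1 E; rewrite E1.
  have F0 : 0 ^+ #|F| = 0 :> E by rewrite expr0n gtn_eqF // ltnW.
  rewrite (big_morph (fun y => y ^+ #|F|) (fun y z => exprDn_pchar y z F_nat)
             F0) /S.
  case: d cardE d_gt0 {S} => // d cardE _.
  rewrite big_ord_recr big_ord_recl /= addrC -exprM -expnSr -cardE expf_card.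
  by congr (_ + _); apply: eq_bigr => i _; rewrite -exprM -expnSr.
case: (@pickP F (fun y => iota y == S)) => [y /eqP // | no_root]; exfalso.
have : root ('X^#|F| - 'X : {poly E}) S by rewrite rootE !hornerE S_fix subrr.
have -> : 'X^#|F| - 'X = \prod_(a <- map iota (enum F)) ('X - a%:P) :> {poly E}.
  have := congr1 (map_poly iota) (finField_genPoly F).
  rewrite rmorphB /= map_polyXn map_polyX => ->.
  rewrite rmorph_prod big_map big_enum /=.
  by apply: eq_bigr => y _; rewrite map_polyXsubC.
by rewrite root_prod_XsubC => /mapP[y _ S_eq]; have := no_root y; rewrite S_eq eqxx.
Qed.

(* The map c |-> c%:R is the embedding of the prime field when E has
   characteristic p. *)
Definition tr1 (p : nat) (E : finFieldType) : E -> 'F_p :=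
  tr (fun c : 'F_p => (nat_of_ord c)%:R : E).

Lemma tr1P (p : nat) (E : finFieldType) (d : nat) (x : E) :
  prime p -> #|E| = (p ^ d)%N ->
  (nat_of_ord (tr1 p x))%:R = \sum_(i < d) x ^+ (p ^ i) :> E.
Proof.
move=> p_pr cardE; have pE := card_finPcharP cardE p_pr.
pose emb (c : 'F_p) : E := (nat_of_ord c)%:R.
have emb_nat m : emb m%:R = m%:R by rewrite /emb val_Fp_nat // (GRing.natr_mod_pchar pE).
have emb_additive : zmod_morphism emb.
  move=> a b; apply/eqP; rewrite eq_sym subr_eq; apply/eqP.
  rewrite -[in LHS](subrK b a); set c := a - b.
  by rewrite -[in LHS](natr_Zp c) -[in LHS](natr_Zp b) -natrD emb_nat natrD.
have emb_multiplicative : monoid_morphism emb.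
  split=> [|a b]; first exact: emb_nat 1%N.
  by rewrite -[in LHS](natr_Zp a) -[in LHS](natr_Zp b) -natrM emb_nat natrM.
pose addM := GRing.isZmodMorphism.Build _ _ emb emb_additive.
pose mulM := GRing.isMonoidMorphism.Build _ _ emb emb_multiplicative.
pose embR : {rmorphism 'F_p -> E} := HB.pack emb addM mulM.
by have := @trP _ _ embR d x; rewrite card_Fp //; apply.
Qed.

(* exp(2 i pi / p): p.-root picks the p-th root of minimal argument, so that
   p.-root (-1) is exp(i pi / p). *)
Definition zeta (p : nat) : algC := (p.-root (-1)) ^+ 2.

Lemma zeta_primitive (p : nat) : prime p -> p.-primitive_root (zeta p).
Proof.
move=> p_pr; have p_gt1 := prime_gt1 p_pr; have p_gt0 := ltnW p_gt1.
set w := p.-root (-1 : algC); have wp : w ^+ p = -1 by rewrite rootCK.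
have zp : zeta p ^+ p = 1 by rewrite /zeta -/w exprAC wp sqrrN expr1n.
have z1 : zeta p != 1.
  rewrite /zeta -/w sqrf_eq1; apply/norP; split; apply/eqP => w1.
    by move/eqP: wp; rewrite w1 expr1n eq_sym eqNr oner_eq0.
  by have := rootC_lt0 (-1 : algC) p_gt1; rewrite -/w w1 oppr_lt0 ltr01.
have [m m_prim m_dvd] := prim_order_exists p_gt0 zp.
have /orP[/eqP m_eq | /eqP m_eq] := (primeP p_pr).2 m m_dvd; last first.
  by rewrite m_eq in m_prim.
by move: z1; rewrite -(prim_expr_order m_prim) m_eq expr1 eqxx.
Qed.

Section Bent.

Variables (p : nat) (W : finZmodType) (form : W -> W -> 'F_p).

Definition Walsh (f : W -> 'F_p) (b : W) : algC :=
  \sum_(x : W) zeta p ^+ nat_of_ord (f x - form b x).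

(* p ^ (N / 2), where N is the dimension of W over the prime field *)
Definition half_order : algC := p%:R ^+ (logn p #|W|)./2.

Definition bent (f : W -> 'F_p) : Prop :=
  forall b, `|Walsh f b| = half_order.

(* The pair (e, c) with Walsh f b = (-1) ^ e * p ^ (N / 2) * zeta ^ c. For p odd
   there is at most one such pair, and for f bent and N even there is one. *)
Definition Walsh_polar (f : W -> 'F_p) (b : W) : bool * 'F_p :=
  odflt (false, 0)
    [pick ec : bool * 'F_p |
      Walsh f b == (-1) ^+ ec.1 * half_order * zeta p ^+ nat_of_ord ec.2].

Definition Walsh_sign (f : W -> 'F_p) (b : W) : algC :=
  (-1) ^+ (Walsh_polar f b).1.

Definition dual (f : W -> 'F_p) (b : W) : 'F_p := (Walsh_polar f b).2.

Definition weakly_regular (f : W -> 'F_p) : Prop :=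
  bent f /\ exists e : algC, forall b, Walsh_sign f b = e.

Definition non_weakly_regular (f : W -> 'F_p) : Prop :=
  bent f /\ ~ weakly_regular f.

Section Vectorial.

Variable Fr : finFieldType.

Definition component (F : W -> Fr) (t : Fr) (x : W) : 'F_p := tr1 p (t * F x).

Definition vectorial_bent (F : W -> Fr) : Prop :=
  forall t, t != 0 -> bent (component F t).

(* A permutation of the nonzero elements of Fr is given as a permutation of Fr
   that fixes 0. *)
Definition vectorial_dual_bent (F : W -> Fr) : Prop :=
  vectorial_bent F /\
  exists (G : W -> Fr) (sigma : {perm Fr}),
    [/\ vectorial_bent G, sigma 0 = 0 &
        forall t, t != 0 -> dual (component F t) =1 component G (sigma t)].

End Vectorial.

Definition character_sum (xi : W) (S : {set W}) : algC :=
  \sum_(x in S) zeta p ^+ nat_of_ord (- form xi x).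

Definition dual_partition (Omega : {set {set W}}) : {set {set W}} :=
  equivalence_partition
    (fun xi eta => [forall S in Omega, character_sum xi S == character_sum eta S])
    [set: W].

Definition Fourier_reflexive (Omega : {set {set W}}) : Prop :=
  [/\ partition Omega [set: W], [set 0] \in Omega &
      #|dual_partition Omega| = #|Omega|].

End Bent.

Section Schemes.

Variable X : finType.
Implicit Types (A B C : {set X * X}) (R : {set {set X * X}}).

Definition diagonal : {set X * X} := [set xy | xy.1 == xy.2].

Definition converse A : {set X * X} := [set xy | (xy.2, xy.1) \in A].

Definition nb_paths A B (x y : X) : nat :=
  #|[set z | ((x, z) \in A) && ((z, y) \in B)]|.

Record assoc_scheme (d : nat) R : Prop := AssocScheme {
  scheme_partition : partition R [set: X * X];
  scheme_classes : #|R| = d.+1;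
  scheme_diagonal : diagonal \in R;
  scheme_converse : forall A, A \in R -> converse A \in R;
  scheme_regular : forall A B C, A \in R -> B \in R -> C \in R ->
    forall x y x' y', (x, y) \in C -> (x', y') \in C ->
    nb_paths A B x y = nb_paths A B x' y';
  scheme_commutative : forall A B, A \in R -> B \in R ->
    forall x y, nb_paths A B x y = nb_paths B A x y
}.

Definition symmetric_scheme (d : nat) R : Prop :=
  assoc_scheme d R /\ forall A, A \in R -> converse A = A.

Definition fusion_scheme (d : nat) (R' R : {set {set X * X}}) : Prop :=
  assoc_scheme d R' /\
  forall A, A \in R' -> exists2 T : {set {set X * X}}, T \subset R & A = cover T.

End Schemes.

Definition relations (W : finZmodType) (Omega : {set {set W}}) :
    {set {set W * W}} :=
  [set [set xy : W * W | xy.2 - xy.1 \in U] | U : {set W} in Omega].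

Section Subspaces.

Variables (Fr Fq : finFieldType) (iota : Fr -> Fq).

Definition subspace (K : {set Fq}) : Prop :=
  0 \in K /\ forall a x y, x \in K -> y \in K -> iota a * x + y \in K.

Definition lines : {set {set Fq}} :=
  [set [set iota a * z | a : Fr] | z : Fq & z != 0].

End Subspaces.

Definition trace_perp (p : nat) (Fq : finFieldType) (K : {set Fq}) : {set Fq} :=
  [set y | [forall z in K, tr1 p (z * y) == 0]].

Section Partitions.

Variables (Fn Fq : finFieldType).
Local Notation V := (Fn * Fq * Fq)%type.

Definition V_form (p : nat) (a b : V) : 'F_p :=
  tr1 p (a.1.1 * b.1.1) + tr1 p (a.1.2 * b.1.2) + tr1 p (a.2 * b.2).

Section Cells.

(* H : V -> T, and P0 = H(., 0, 0); T is the field with r or with r' elements. *)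
Variables (T : finType) (H : V -> T) (P0 : Fn -> T).

Definition e_cell (i : T) : {set V} :=
  [set v | [&& v.1.1 != 0, v.2 == 0 & P0 v.1.1 == i]].

Definition c_line_cell (L : {set Fq}) (i : T) : {set V} :=
  [set v | (v.2 \in L :\ 0) && (H v == i)].

Definition B_line_cell (L : {set Fq}) : {set V} :=
  [set v | [&& v.1.1 == 0, v.2 == 0 & v.1.2 \in L :\ 0]].

Definition c_cell (K0 : {set Fq}) (i : T) : {set V} :=
  [set v | (v.2 \notin K0) && (H v == i)].

Definition d_cell (K0 : {set Fq}) (i : T) : {set V} :=
  [set v | (v.2 \in K0 :\ 0) && (H v == i)].

Definition B1_cell (p : nat) (K0 : {set Fq}) : {set V} :=
  [set v | [&& v.1.1 == 0, v.2 == 0 & v.1.2 \in trace_perp p K0 :\ 0]].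

Definition B2_cell (p : nat) (K0 : {set Fq}) : {set V} :=
  [set v | [&& v.1.1 == 0, v.2 == 0 & v.1.2 \notin trace_perp p K0]].

Definition Omega (p : nat) (K0 : {set Fq}) : {set {set V}} :=
  ([set [set (0 : V)]; B1_cell p K0; B2_cell p K0]
     :|: [set e_cell i | i : T] :|: [set d_cell K0 i | i : T]
     :|: [set c_cell K0 i | i : T]) :\ set0.

End Cells.

Variables (Fr : finFieldType) (iota : Fr -> Fq).

Definition H_of (P : Fq -> Fn -> Fr) (v : V) : Fr :=
  P v.2 v.1.1 + tr iota (v.1.2 * v.2).

Definition Omega_s (H : V -> Fr) (P0 : Fn -> Fr) : {set {set V}} :=
  [set [set (0 : V)]]
    :|: [set e_cell P0 i | i : Fr & (i != 0) || (e_cell P0 i != set0)]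
    :|: [set c_line_cell H L i | L in lines iota, i in [set: Fr]]
    :|: [set B_line_cell L | L in lines iota].

End Partitions.

Section Choices.

Variables (p n s : nat) (Fr Fq Fn : finFieldType) (iota : {rmorphism Fr -> Fn}).

(* Fn is identified with Fm * Fm by the basis (b1, b2) over Fm. The embeddings
   Fr -> Fm -> Fn are required to compose to iota, as inclusions would. *)
Definition choice_a (P : Fq -> Fn -> Fr) : Prop :=
  exists (m : nat) (Fm : finFieldType)
    (iota_rm : {rmorphism Fr -> Fm}) (iota_mn : {rmorphism Fm -> Fn})
    (b1 b2 : Fn),
  let of_coords (x : Fm * Fm) := iota_mn x.1 * b1 + iota_mn x.2 * b2 in
  [/\ n = (2 * m)%N, (s %| m)%N & #|Fm| = (p ^ m)%N] /\
  (p = 1 %[mod 4] \/ (p = 3 %[mod 4] /\ n = 0 %[mod 4])) /\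
  [/\ iota_mn \o iota_rm =1 iota,
      bijective of_coords,
      forall x, P 0 x = tr iota (x ^+ 2) &
      forall z, z != 0 ->
        forall x, P z (of_coords x) = tr iota_rm (x.1 * x.2)].

Definition choice_b (P : Fq -> Fn -> Fr) : Prop :=
  exists nu : Fr,
  [/\ ~~ odd n, (s %| n)%N, odd (n %/ s) & (3 <= n %/ s)%N] /\
  [/\ forall a : Fr, a ^+ 2 != nu,
      forall x, P 0 x = tr iota (x ^+ 2) &
      forall z, z != 0 -> forall x, P z x = tr iota (iota nu * x ^+ 2)].

End Choices.

(* Main.v *)
Require Import Defs.
From HB Require Import structures.
From mathcomp Require Import all_boot all_order all_algebra all_fingroup all_solvable all_field.
From mathcomp Require Import ring zify.

(* Write psi for the additive character c |-> zeta_p ^ c of F_p. Both choices consist of quadratic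
   forms whose Walsh transforms are (-1)^e(t) p^(n/2) psi(- Tr(Q / t)) for a dual form Q, with
   opposite signs e for z = 0 and z <> 0. Summing over y first, the Walsh transform of H_t at
   (u, v, w) only sees z = v / t, so its sign depends on whether v = 0, and its dual is
   - Tr(H*(u, v, w) / t), where H* has the shape of H with y and z exchanged.

   All the partitions are level sets of a label on V, and by the same computation the character
   sums of the cells are functions of the corresponding label for H*. Both labels take the same
   values, so the dual partition has no more cells than the partition itself. Then the character
   sums of the cells, which are linearly independent by Fourier inversion, span all functions that
   are constant on the dual cells; this span is closed under products, which says that the span of
   the indicators of the cells is closed under convolution, i.e. that the cells induce an
   association scheme.

   In (a) the sign at z = 0 is -1, because Tr(x^2) from F_(p^n) to F_(p^m) is anisotropic; in (b)
   the two signs are opposite, because nu remains a nonsquare in an extension of odd degree. *)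

Set Implicit Arguments.
Unset Strict Implicit.
Unset Printing Implicit Defensive.

Import Order.TTheory GRing.Theory Num.Theory.
Local Open Scope ring_scope.

(** * Additive characters and traces *)

(** Why the two labels have the same values: for z <> 0 the coordinate y makes H take every value,
    so only the values of P^(0) at nonzero x are in doubt. Completing the square shows that the dual
    form of P^(0) is P^(0) / 4, and the set of values of Tr(beta P^(0)) at nonzero x is the same for
    all beta <> 0: everything, or everything except 0. Whether 0 occurs is the meaning of [delta]; a
    trace to a proper subfield has a kernel, so 0 always occurs for s' < s and delta' = 1 there. The
    change of sign that destroys weak regularity does no harm to the schemes, because the dual label
    records whether v = 0. All partitions are treated at once by labelling z <> 0 with [kappa z] and
    the points (0, y, 0) with [lambda y]. The two maps only have to be dual to each other: character
    sums over the cells of either one are functions of the other. This holds for F_r-lines paired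
    with F_r-lines, and for a subspace paired with its trace-orthogonal. *)

Definition psi (p : nat) (c : 'F_p) : algC := zeta p ^+ nat_of_ord c.

Lemma psi0 (p : nat) : psi (0 : 'F_p) = 1.
Proof. by []. Qed.

Section ZmodMorphism.

Variables (U V : zmodType) (f : U -> V).
Hypothesis f_add : zmod_morphism f.

Lemma zmod_morph0 : f 0 = 0.
Proof. by rewrite -(subrr 0) f_add subrr. Qed.

Lemma zmod_morphN x : f (- x) = - f x.
Proof. by rewrite -[- x]sub0r f_add zmod_morph0 sub0r. Qed.

Lemma zmod_morphD x y : f (x + y) = f x + f y.
Proof. by rewrite -[y in LHS]opprK f_add zmod_morphN opprK. Qed.

End ZmodMorphism.

Section PrimeField.

Variable p : nat.
Hypothesis p_pr : prime p.

Lemma psiD : {morph @psi p : a b / a + b >-> a * b}.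
Proof.
move=> a b; rewrite /psi -exprD -[RHS](expr_mod _ (prim_expr_order (zeta_primitive p_pr))).
by congr (_ ^+ _); congr (_ %% _)%N; apply: Fp_cast.
Qed.

Lemma psi_neq0 (c : 'F_p) : psi c != 0.
Proof.
apply/expf_neq0/eqP => z0; have := prim_expr_order (zeta_primitive p_pr).
by move/eqP; rewrite z0 expr0n gtn_eqF ?prime_gt0 // eq_sym oner_eq0.
Qed.

Lemma psi_inj : injective (@psi p).
Proof.
move=> a b /eqP; rewrite /psi (eq_prim_root_expr (zeta_primitive p_pr)).
have lt_p (c : 'F_p) : (c < p)%N by have := ltn_ord c; rewrite [X in (_ < X)%N]Fp_cast.
by rewrite eqn_mod_dvd_or_modn // || rewrite !modn_small ?lt_p // => /eqP/val_inj.
Qed.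

Lemma psi_eq1 (c : 'F_p) : (psi c == 1) = (c == 0).
Proof. by rewrite -[1](psi0 p) (inj_eq psi_inj). Qed.

Lemma norm_psi (c : 'F_p) : `|psi c| = 1.
Proof.
apply/eqP; rewrite /psi normrX; apply/eqP.
have /eqP := congr1 Num.norm (prim_expr_order (zeta_primitive p_pr)).
rewrite normrX normr1 pexpr_eq1 ?prime_gt0 // => /eqP ->; exact: expr1n.
Qed.

(** Translation by an element a of [A] permutes the terms and multiplies the sum by psi (f a), so
    the sum is 0 as soon as one such factor differs from 1. *)
Lemma sum_psi_subgroup (G : finZmodType) (f : G -> 'F_p) (A : {pred G}) :
    zmod_morphism f -> (forall x y, x \in A -> (x + y \in A) = (y \in A)) ->
  \sum_(x in A) psi (f x) = if [forall x in A, f x == 0] then #|A|%:R else 0.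
Proof.
move=> f_add A_add; have fD := zmod_morphD f_add.
case: ifP => [/forallP all0 | /negbT /forallPn [a]].
  rewrite -sum1_card natr_sum; apply: eq_bigr => x Ax.
  by have /implyP/(_ Ax)/eqP -> := all0 x; rewrite psi0.
rewrite negb_imply => /andP[Aa fa].
set S := \sum_(_ in _) _; have : psi (f a) * S = S.
  rewrite mulr_sumr /S [RHS](reindex_inj (addrI a)) /=.
  by apply: eq_big => [x | x _]; rewrite ?A_add // fD psiD.
move/eqP; rewrite -[X in _ == X]mul1r -subr_eq0 -mulrBl mulf_eq0 subr_eq0 psi_eq1.
by rewrite (negPf fa) => /eqP.
Qed.

Section Field.

Variables (E : finFieldType) (d : nat).
Hypothesis cardE : #|E| = (p ^ d)%N.

Let pE : p \in [pchar E]. Proof. exact: card_finPcharP cardE p_pr. Qed.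

Lemma Fp_embedding :
  exists f : {rmorphism 'F_p -> E}, forall c, f c = (nat_of_ord c)%:R.
Proof.
pose emb (c : 'F_p) : E := (nat_of_ord c)%:R.
have emb_nat m : emb m%:R = m%:R by rewrite /emb val_Fp_nat // (GRing.natr_mod_pchar pE).
have emb_additive : zmod_morphism emb.
  move=> a b; apply/eqP; rewrite eq_sym subr_eq; apply/eqP.
  rewrite -[in LHS](subrK b a); set c := a - b.
  by rewrite -[in LHS](natr_Zp c) -[in LHS](natr_Zp b) -natrD emb_nat natrD.
have emb_multiplicative : monoid_morphism emb.
  split=> [|a b]; first exact: emb_nat 1%N.
  by rewrite -[in LHS](natr_Zp a) -[in LHS](natr_Zp b) -natrM emb_nat natrM.
pose addM := GRing.isZmodMorphism.Build _ _ emb emb_additive.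
pose mulM := GRing.isMonoidMorphism.Build _ _ emb emb_multiplicative.
by exists (HB.pack emb addM mulM : {rmorphism 'F_p -> E}).
Qed.

Lemma Frobenius_sumB (i : nat) (x y : E) :
  (x - y) ^+ (p ^ i) = x ^+ (p ^ i) - y ^+ (p ^ i).
Proof.
have pi_nat : [pchar E].-nat (p ^ i)%N by rewrite (eq_pnat _ (pcharf_eq pE)) pnatX pnat_id.
have odd_sign : (-1) ^+ (p ^ i) = -1 :> E.
  apply/eqP; rewrite -addr_eq0 -[X in _ + X](expr1n E (p ^ i)) -exprDn_pchar //.
  by rewrite addrC subrr expr0n expn_eq0 (gtn_eqF (prime_gt0 p_pr)).
by rewrite exprDn_pchar // -mulN1r exprMn odd_sign mulN1r.
Qed.

Lemma tr1_additive : zmod_morphism (@tr1 p E).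
Proof.
have [f fE] := Fp_embedding; move=> x y; apply: (fmorph_inj f).
rewrite rmorphB !fE !(tr1P _ p_pr cardE) -sumrB.
by apply: eq_bigr => i _; apply: Frobenius_sumB.
Qed.

Lemma tr1_0 : tr1 p (0 : E) = 0.
Proof. exact: zmod_morph0 tr1_additive. Qed.

Lemma tr1N (x : E) : tr1 p (- x) = - tr1 p x.
Proof. exact: zmod_morphN tr1_additive x. Qed.

Lemma tr1D (x y : E) : tr1 p (x + y) = tr1 p x + tr1 p y.
Proof. exact: zmod_morphD tr1_additive x y. Qed.

(** The trace is a nonzero polynomial in x of degree below p^d, so the p^d elements of E cannot all
    be roots. *)
Lemma tr1_nonzero : exists x : E, tr1 p x != 0.
Proof.
have d_gt0 : (0 < d)%N by have := finNzRing_gt1 E; rewrite cardE; case: (d).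
have p_gt1 := prime_gt1 p_pr.
apply/existsP; rewrite -[X in is_true X]negbK negb_exists; apply/negP => /forallP tr_eq0.
pose T : {poly E} := \sum_(i < d) 'X^(p ^ i).
have T_nz : T != 0.
  apply/eqP => /(congr1 (fun f : {poly E} => f`_1)) /eqP; rewrite coef0 coef_sum.
  rewrite (bigD1 (Ordinal d_gt0)) //= coefXn eqxx big1 ?addr0 ?oner_eq0 // => i i_nz.
  rewrite coefXn -[1%N](expn0 p) eqn_exp2l //.
  by case: eqP => // i0; case/eqP: i_nz; apply: val_inj; rewrite /= -i0.
have : (size (enum E) < size T)%N.
  apply: max_poly_roots => //; last exact: enum_uniq.
  apply/allP => x _; rewrite rootE horner_sum.
  under eq_bigr do rewrite hornerXn.
  by rewrite -tr1P //; have := tr_eq0 x; rewrite negbK => /eqP ->.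
rewrite -cardT ltnNge => /negP; apply.

apply: leq_trans (size_sum _ _ _) _; apply/bigmax_leqP => i _.
by rewrite size_polyXn cardE ltn_exp2l.
Qed.

Lemma sum_psi_tr1 (A : {pred E}) (a : E) :
    (forall x y, x \in A -> (x + y \in A) = (y \in A)) ->
  \sum_(x in A) psi (tr1 p (a * x)) =
    if [forall x in A, tr1 p (a * x) == 0] then #|A|%:R else 0.
Proof.
move=> A_add; apply: (sum_psi_subgroup (f := fun x => tr1 p (a * x))) => // x y.
by rewrite mulrBr tr1_additive.
Qed.

Lemma tr1_nondegenerate (a : E) : (forall x, tr1 p (a * x) = 0) -> a = 0.
Proof.
move=> a0; apply/eqP/negPn/negP => nz_a; have [x] := tr1_nonzero.
by rewrite -[x](mulVKf nz_a) a0 eqxx.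
Qed.

Lemma sum_psi_all (a : E) : \sum_x psi (tr1 p (a * x)) = if a == 0 then #|E|%:R else 0.
Proof.
have -> : \sum_x psi (tr1 p (a * x)) = \sum_(x in predT) psi (tr1 p (a * x)) by [].
rewrite sum_psi_tr1 //; congr (if _ then _ else _).
apply/forallP/eqP => [a0 | -> x]; last by rewrite mul0r tr1_0 eqxx.
by apply: tr1_nondegenerate => x; apply/eqP/a0.
Qed.

End Field.

Section Trace.

Variables (F E : finFieldType) (iota : {rmorphism F -> E}) (s d : nat).
Hypotheses (cardF : #|F| = (p ^ s)%N) (cardE : #|E| = (p ^ d)%N) (s_dvd_d : (s %| d)%N).

Let cardEF : #|E| = (#|F| ^ (d %/ s))%N.
Proof. by rewrite cardF -expnM mulnC divnK. Qed.

Lemma tr_additive : zmod_morphism (tr iota).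
Proof.
move=> x y; apply: (fmorph_inj iota); rewrite rmorphB !(trP _ _ cardEF) -sumrB.
by apply: eq_bigr => i _; rewrite cardF -expnM (Frobenius_sumB cardE).
Qed.

Lemma tr_0 : tr iota 0 = 0.
Proof. exact: zmod_morph0 tr_additive. Qed.

Lemma tr_scale (a : F) (x : E) : tr iota (iota a * x) = a * tr iota x.
Proof.
apply: (fmorph_inj iota); rewrite rmorphM !(trP _ _ cardEF) mulr_sumr.
apply: eq_bigr => i _; rewrite exprMn -rmorphXn; congr (iota _ * _).
elim: (nat_of_ord i) => [|j IHj]; first by rewrite expn0 expr1.
by rewrite expnSr exprM IHj expf_card.
Qed.

Lemma sum_base (c e : nat) (f : nat -> E) :
  \sum_(i < c) \sum_(j < e) f (e * i + j)%N = \sum_(l < e * c) f l.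
Proof.
elim: c => [|c IHc]; first by rewrite muln0 !big_ord0.
rewrite big_ord_recr /= IHc mulnS addnC big_split_ord /=; congr (_ + _).
Qed.

(** Transitivity of the trace. The exponents l < d are s i + j with j < s, and for fixed j the
    powers of x over all i add up to the p^j-th power of the trace of x to F. *)
Lemma tr1_tr (x : E) : tr1 p (tr iota x) = tr1 p x.
Proof.
have [f fE] := Fp_embedding cardE; apply: (fmorph_inj f).
rewrite !fE (tr1P _ p_pr cardE).
have -> : (nat_of_ord (tr1 p (tr iota x)))%:R = iota (nat_of_ord (tr1 p (tr iota x)))%:R.
  by rewrite rmorph_nat.
rewrite (tr1P _ p_pr cardF) rmorph_sum /=.
have -> : (d = s * (d %/ s))%N by rewrite mulnC divnK.
rewrite -(sum_base _ _ (fun l => x ^+ (p ^ l))) exchange_big /=.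
apply: eq_bigr => i _; rewrite rmorphXn (trP _ _ cardEF).
elim: (d %/ s)%N => [|c IHc].
  by rewrite !big_ord0 expr0n expn_eq0 (gtn_eqF (prime_gt0 p_pr)).
rewrite !big_ord_recr /= -IHc [in RHS]expnD expnM -cardF exprM.
set a := \sum_(_ < _) _; set b := x ^+ _.
have := Frobenius_sumB cardE i (a + b) b; rewrite addrK => ->.
by rewrite subrK.
Qed.

Lemma tr_surj (c : F) : exists x, tr iota x = c.
Proof.
have [x x_nz] := tr1_nonzero cardE.
have t_nz : tr iota x != 0 by apply: contraNneq x_nz => t0; rewrite -tr1_tr t0 (tr1_0 cardF).
by exists (iota (c / tr iota x) * x); rewrite tr_scale divfK.
Qed.

End Trace.

End PrimeField.

(** * Level sets and translation schemes *)

Section LevelSets.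

Variables (T : finType) (L : finType) (Phi : T -> L).

Lemma leq_card_factor (L' : finType) (Phi' : T -> L') :
  (forall x y, Phi x = Phi y -> Phi' x = Phi' y) ->
  (#|Phi' @: [set: T]| <= #|Phi @: [set: T]|)%N.
Proof.
move=> Phi_fact.
(* [option] provides a value at the labels that are not attained, where L' need not contain
   anything. *)
pose h l := if [pick x | Phi x == l] is Some x then Some (Phi' x) else None.
have hE x : h (Phi x) = Some (Phi' x).
  rewrite /h; case: pickP => [y /eqP /Phi_fact -> // | /(_ x)]; by rewrite eqxx.
have Some_injective : injective (@Some L') by move=> a b [].
rewrite -(card_imset _ Some_injective).
have -> : Some @: (Phi' @: [set: T]) = h @: (Phi @: [set: T]).
  by rewrite -!imset_comp; apply: eq_imset => x /=; rewrite hE.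
exact: leq_imset_card.
Qed.

Definition level (l : L) : {set T} := [set x | Phi x == l].

Lemma mem_preim_partition (S : {set T}) :
  reflect (exists x, S = level (Phi x)) (S \in preim_partition Phi [set: T]).
Proof.
have levelE x : [set y in [set: T] | Phi x == Phi y] = level (Phi x).
  by apply/setP=> y; rewrite !inE eq_sym.
apply: (iffP imsetP) => [[x _ ->] | [x ->]]; exists x; rewrite ?levelE //.
Qed.

Lemma card_preim_partition : #|preim_partition Phi [set: T]| = #|Phi @: [set: T]|.
Proof.
rewrite -(card_in_imset (f := level) (D := Phi @: [set: T])).
  congr #|pred_of_set _|; apply/setP => S.
  apply/mem_preim_partition/imsetP => [[x ->] | [_ /imsetP[x _ ->] ->]].
    by exists (Phi x) => //; apply: imset_f.
  by exists x.
move=> _ _ /imsetP[x _ ->] /imsetP[y _ ->] /setP/(_ x).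
by rewrite !inE eqxx => /esym/eqP.
Qed.

Lemma preim_partition_setT : partition (preim_partition Phi [set: T]) [set: T].
Proof. exact: preim_partitionP. Qed.

Lemma preim_partition_inj (Phi' : T -> L) x y :
  preim_partition Phi [set: T] = preim_partition Phi' [set: T] ->
  Phi x = Phi y -> Phi' x = Phi' y.
Proof.
move=> eq_part Phi_xy; have : level (Phi x) \in preim_partition Phi [set: T].
  by apply/mem_preim_partition; exists x.
rewrite eq_part => /imsetP[z _ /setP lev_z].
have := lev_z x; have := lev_z y.
by rewrite !inE Phi_xy eqxx => /esym/eqP <- /esym/eqP <-.
Qed.

End LevelSets.

(** * Fourier transform on W, dual partitions and convolution of cells *)

Section TranslationScheme.

Variables (p : nat) (W : finZmodType) (form : W -> W -> 'F_p).
Hypotheses (p_pr : prime p).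
Hypotheses (formBl : forall x, zmod_morphism (form^~ x)).
Hypotheses (formBr : forall xi, zmod_morphism (form xi)).
Hypothesis form_nondeg : forall x, (forall xi, form xi x = 0) -> x = 0.

Definition Fourier (g : W -> algC) (xi : W) : algC := \sum_x g x * psi (- form xi x).

Lemma Fourier_inversion (g : W -> algC) (x : W) :
  \sum_xi Fourier g xi * psi (form xi x) = #|W|%:R * g x.
Proof.
transitivity (\sum_y g y * \sum_xi psi (form xi (x - y))).
  under eq_bigr do rewrite mulr_suml; rewrite exchange_big /=.
  apply: eq_bigr => y _; rewrite mulr_sumr; apply: eq_bigr => xi _.
  by rewrite formBr addrC psiD // mulrA.
have sumE y : \sum_xi psi (form xi (x - y)) = if x == y then #|W|%:R else 0.
  have -> : \sum_xi psi (form xi (x - y)) = \sum_(xi in predT) psi (form xi (x - y)) by [].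
  rewrite (sum_psi_subgroup p_pr (formBl _)) //; congr (if _ then _ else _).
  apply/forallP/eqP => [f0 | -> xi].
    by apply/eqP; rewrite -subr_eq0; apply/eqP/form_nondeg => xi; apply/eqP/f0.
  by rewrite subrr (zmod_morph0 (formBr _)) eqxx implybT.
under eq_bigr do rewrite sumE.
rewrite (bigD1 x isT) big1 /=; first by rewrite (eqxx x) addr0 mulrC.
by move=> y /negPf y_x; rewrite eq_sym y_x mulr0.
Qed.

Lemma Fourier_inj (g h : W -> algC) : Fourier g =1 Fourier h -> g =1 h.
Proof.
move=> gh x; have W_nz : #|W|%:R != 0 :> algC.
  by rewrite pnatr_eq0 -lt0n; apply/card_gt0P; exists 0.
by apply: (mulfI W_nz); rewrite -!Fourier_inversion; apply: eq_bigr => xi _; rewrite gh.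
Qed.

Variables (L : finType) (Phi : W -> L).

Let Omega := preim_partition Phi [set: W].
Let cell l := level Phi l.
Let same_sums xi eta := [forall S in Omega, character_sum form xi S == character_sum form eta S].

Lemma Fourier_cell l xi :
  Fourier (fun x => (Phi x == l)%:R) xi = character_sum form xi (cell l).
Proof.
rewrite /Fourier /character_sum [RHS]big_mkcond /=; apply: eq_bigr => x _.
by rewrite inE; case: ifP; rewrite ?mul1r ?mul0r.
Qed.

Lemma same_sumsP xi eta :
  reflect (forall l, character_sum form xi (cell l) = character_sum form eta (cell l))
    (same_sums xi eta).
Proof.
apply: (iffP forallP) => [sums l | sums S]; last first.
  by apply/implyP => /mem_preim_partition[x ->]; apply/eqP.
have [-> | [x]] := set_0Vmem (cell l); first by rewrite /character_sum !big_set0.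
rewrite inE => /eqP <-; have /implyP sum_x := sums (cell (Phi x)).
by apply/eqP/sum_x/mem_preim_partition; exists x.
Qed.

Lemma same_sums_equiv : {in [set: W] & &, equivalence_rel same_sums}.
Proof.
move=> x y z _ _ _; split; first by apply/same_sumsP.
by move/same_sumsP => xy; apply/same_sumsP/same_sumsP => xz l; rewrite -xz xy.
Qed.

Let N := #|Phi @: [set: W]|.
Let D := #|dual_partition form Omega|.

(** One point in each dual cell reduces all character sums of the cells to a matrix with N rows and
    D columns. *)
Lemma dual_representatives : exists rep : 'I_D -> W, forall xi, exists j, same_sums xi (rep j).
Proof.
have /cover_partition cov := equivalence_partitionP same_sums_equiv.
have cell_ex (j : 'I_D) : exists xi, enum_val j == [set y in [set: W] | same_sums xi y].
  by have /imsetP[xi _ ->] := enum_valP j; exists xi.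
exists (fun j => xchoose (cell_ex j)) => xi.
have xi_in : [set y in [set: W] | same_sums xi y] \in dual_partition form Omega.
  exact: imset_f.
exists (enum_rank_in xi_in [set y in [set: W] | same_sums xi y]).
have /eqP := xchooseP (cell_ex (enum_rank_in xi_in [set y in [set: W] | same_sums xi y])).
set eta := xchoose _; rewrite enum_rankK_in // => /setP/(_ eta).
rewrite !inE /= => ->; exact/same_sumsP.
Qed.

(** A relation v between the rows says that the function with value v_i on the i-th cell has a
    Fourier transform that vanishes at the representatives, hence everywhere; inversion makes the
    function 0. In particular N <= D. *)
Lemma character_sums_row_free (rep : 'I_D -> W)
    (rep_ex : forall xi, exists j, same_sums xi (rep j)) :
  row_free (\matrix_(i < N, j < D) character_sum form (rep j) (cell (enum_val i))).
Proof.
apply: inj_row_free => v vB0.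
pose h x := \sum_(i < N) v 0 i * (Phi x == enum_val i)%:R.
have h0 : h =1 fun=> 0.
  apply: Fourier_inj => xi; have [j /same_sumsP sums] := rep_ex xi.
  have -> : Fourier (fun=> 0) xi = 0 by rewrite /Fourier big1 // => x _; rewrite mul0r.
  have := congr1 (fun M : 'rV_D => M 0 j) vB0; rewrite !mxE => <-.
  rewrite /Fourier; under eq_bigr do rewrite mulr_suml; rewrite exchange_big /=.
  apply: eq_bigr => i _; rewrite mxE -sums -Fourier_cell mulr_sumr.
  by apply: eq_bigr => x _; rewrite mulrA.
apply/rowP => i; rewrite mxE; have /imsetP[x _ xi] := enum_valP i.
have := h0 x; rewrite /h (bigD1 i) //= -xi eqxx mulr1 big1 ?addr0 // => i' i'_nz.
rewrite xi; case: eqP => [ii' | _]; last by rewrite mulr0.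
by case/eqP: i'_nz; apply: enum_val_inj; rewrite xi ii'.
Qed.

Variables (L' : finType) (Psi : W -> L').
Hypothesis Psi_sums : forall xi eta, Psi xi = Psi eta ->
  forall l, character_sum form xi (cell l) = character_sum form eta (cell l).
Hypothesis card_Psi : (#|Psi @: [set: W]| <= N)%N.

(** The level sets of [Psi] refine the dual cells. In the application [Psi] is the label of the dual
    of H. *)
Lemma dual_partition_leq : (D <= N)%N.
Proof.
apply: leq_trans card_Psi; rewrite /D /dual_partition /equivalence_partition.
apply: leq_card_factor => xi eta /Psi_sums sums; apply/setP => y; rewrite !inE /=.
by apply/same_sumsP/same_sumsP => E l; rewrite -E sums.
Qed.

Lemma card_dual_partition : D = N.
Proof.
have [rep rep_ex] := dual_representatives.
have := character_sums_row_free rep_ex; rewrite /row_free => /eqP rkB.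
by apply/eqP; rewrite eqn_leq dual_partition_leq -[X in (X <= _)%N]rkB rank_leq_col.
Qed.

(** Since D = N, the row-free matrix is invertible, so the values of g at the representatives are a
    combination of its rows; the coefficients form the function c of the label. *)
Lemma dual_constant_span (g : W -> algC) :
    (forall xi eta, same_sums xi eta -> g xi = g eta) ->
  exists c : L -> algC, forall xi, g xi = Fourier (c \o Phi) xi.
Proof.
move=> g_const; have [rep rep_ex] := dual_representatives.
have := character_sums_row_free rep_ex; set B := \matrix_(_, _) _ => freeB.
have fullB : row_full B by rewrite /row_full (eqP freeB) card_dual_partition.
have /submxP[c cB] := submx_full (\row_j g (rep j)) fullB.
exists (fun l => \sum_(i < N) c 0 i * (l == enum_val i)%:R) => xi.
have [j same_j] := rep_ex xi; rewrite (g_const _ _ same_j).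
have := congr1 (fun M : 'rV_D => M 0 j) cB; rewrite !mxE => ->.
rewrite /Fourier /=; under [RHS]eq_bigr do rewrite mulr_suml.
rewrite [RHS]exchange_big /=; apply: eq_bigr => i _.
rewrite mxE; move/same_sumsP: same_j => /(_ (enum_val i)) <-.
rewrite -Fourier_cell mulr_sumr; apply: eq_bigr => x _; by rewrite mulrA.
Qed.

(** The convolution of the indicators of two cells. By translation invariance its values are the
    intersection numbers of the scheme. *)
Definition nb_sums (l1 l2 : L) (s : W) : nat :=
  #|[set x | (Phi x == l1) && (Phi (s - x) == l2)]|.

Lemma Fourier_nb_sums l1 l2 xi :
  Fourier (fun s => (nb_sums l1 l2 s)%:R) xi =
    character_sum form xi (cell l1) * character_sum form xi (cell l2).
Proof.
rewrite -!Fourier_cell /Fourier big_distrlr /=.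
transitivity (\sum_s \sum_x
    (Phi x == l1)%:R * (Phi (s - x) == l2)%:R * psi (- form xi s)).
  apply: eq_bigr => s _; rewrite -mulr_suml; congr (_ * _).
  rewrite /nb_sums -sum1_card natr_sum [LHS]big_mkcond /=; apply: eq_bigr => x _.
  by rewrite inE; do 2!case: eqP; rewrite ?mulr0 ?mul0r ?mulr1.
rewrite exchange_big /=; apply: eq_bigr => x _.
rewrite (reindex_inj (addrI x)) /=; apply: eq_bigr => y _.
by rewrite [x + y - x]addrAC subrr add0r (zmod_morphD (formBr xi)) opprD psiD // mulrACA.
Qed.

(** The product of two character sums is constant on dual cells, hence it is the Fourier transform
    of a function of the label. The convolution has the same transform, so by inversion it is that
    function. *)
Lemma nb_sums_level l1 l2 s s' : Phi s = Phi s' -> nb_sums l1 l2 s = nb_sums l1 l2 s'.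
Proof.
move=> Phi_s.
pose g xi := character_sum form xi (cell l1) * character_sum form xi (cell l2).
have [|c cE] := @dual_constant_span g.
  by move=> xi eta /same_sumsP sums; rewrite /g !sums.
have nbE : (fun s => (nb_sums l1 l2 s)%:R) =1 c \o Phi.
  by apply: Fourier_inj => xi; rewrite Fourier_nb_sums -cE.
by apply/eqP; rewrite -(eqr_nat algC) !nbE /= Phi_s.
Qed.

Hypothesis Phi0 : forall x, Phi x = Phi 0 -> x = 0.
Hypothesis PhiN : forall x, Phi (- x) = Phi x.

Lemma level0 : level Phi (Phi 0) = [set 0].
Proof. by apply/setP => x; rewrite !inE; apply/eqP/eqP => [/Phi0 | ->]. Qed.

Lemma level_Fourier_reflexive : Fourier_reflexive form Omega.
Proof.
split; first exact: preim_partition_setT.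
- by apply/mem_preim_partition; exists 0; rewrite level0.
- by rewrite card_preim_partition; apply: card_dual_partition.
Qed.

Let rel_of l : {set W * W} := [set xy | xy.2 - xy.1 \in cell l].

Lemma mem_relations A :
  reflect (exists x, A = rel_of (Phi x)) (A \in relations Omega).
Proof.
apply: (iffP imsetP) => [[_ /mem_preim_partition[x ->] ->] | [x ->]]; first by exists x.
by exists (cell (Phi x)) => //; apply/mem_preim_partition; exists x.
Qed.

Lemma nb_paths_rel l1 l2 x y : nb_paths (rel_of l1) (rel_of l2) x y = nb_sums l1 l2 (y - x).
Proof.
rewrite /nb_paths /nb_sums -(card_imset _ (addIr (- x))).
congr #|pred_of_set _|; apply/setP => z; rewrite inE.
apply/imsetP/idP => [[w]|].
  by rewrite !inE /= => /andP[A B] ->; rewrite A opprB addrA subrK.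
by exists (z + x); rewrite ?addrK // !inE /= addrK opprD addrA addrAC.
Qed.

Lemma relations_partition : partition (relations Omega) [set: W * W].
Proof.
have -> : relations Omega = preim_partition (fun xy : W * W => Phi (xy.2 - xy.1)) [set: W * W].
  apply/setP => A; apply/mem_relations/mem_preim_partition => [[x ->] | [[x y] ->]].
    by exists (0, x); apply/setP => -[u v]; rewrite !inE /= subr0.
  by exists (y - x); apply/setP => -[u v]; rewrite !inE /=.
exact: preim_partition_setT.
Qed.

Lemma card_relations : #|relations Omega| = N.
Proof.
rewrite /relations card_in_imset ?card_preim_partition //.
move=> _ _ /mem_preim_partition[x ->] /mem_preim_partition[y ->] /setP E.
by apply/setP => z; have := E (0, z); rewrite !inE /= subr0.
Qed.

Lemma level_symmetric_scheme d : N = d.+1 -> symmetric_scheme d (relations Omega).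
Proof.
move=> Nd; have relN A : A \in relations Omega -> converse A = A.
  case/mem_relations => x ->; apply/setP => -[u v].
  by rewrite !inE /= -[u - v]opprB PhiN.
split=> //; split.
- exact: relations_partition.
- by rewrite card_relations.
- apply/mem_relations; exists 0; apply/setP => -[u v].
  by rewrite /rel_of /cell level0 !inE /= subr_eq0 eq_sym.
- by move=> A A_in; rewrite relN.
- move=> _ _ _ /mem_relations[a ->] /mem_relations[b ->] /mem_relations[c ->] x y x' y'.
  rewrite !inE /= => /eqP xy /eqP xy'.
  by rewrite !nb_paths_rel; apply: nb_sums_level; rewrite xy.
- move=> _ _ /mem_relations[a ->] /mem_relations[b ->] x y.
  (* The involution z -> (y - x) - z exchanges the two conditions on z. *)
  rewrite !nb_paths_rel /nb_sums -(card_imset _ (subrI (y - x))).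
  congr #|pred_of_set _|; apply/setP => z; rewrite inE.
  apply/imsetP/idP => [[w]|].
    by rewrite !inE => /andP[A B] ->; rewrite B opprB addrC subrK A.
  move=> /andP[A B]; exists (y - x - z); last by rewrite opprB addrC subrK.
  by rewrite inE B opprB addrC subrK A.
Qed.

End TranslationScheme.

(** Each coarse relation is the union of the fine relations that it contains, because the coarse
    label is a function of the fine one. *)
Lemma level_fusion (W : finZmodType) (L L' : finType) (Phi : W -> L) (Phi' : W -> L') :
    (forall x y, Phi x = Phi y -> Phi' x = Phi' y) ->
  forall A, A \in relations (preim_partition Phi' [set: W]) ->
  exists2 T : {set {set W * W}},
    T \subset relations (preim_partition Phi [set: W]) & A = cover T.
Proof.
move=> Phi_fact _ /imsetP[_ /mem_preim_partition[x ->] ->].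
set A := [set _ | _]; exists [set B in relations (preim_partition Phi [set: W]) | B \subset A].
  by apply/subsetP => B; rewrite inE => /andP[].
apply/setP => -[u v]; apply/idP/bigcupP => [uv_A | [B]]; last first.
  by rewrite inE => /andP[_ /subsetP]; apply.
exists [set xy | xy.2 - xy.1 \in level Phi (Phi (v - u))]; last by rewrite !inE.
rewrite inE; apply/andP; split.
  by apply: imset_f; apply/mem_preim_partition; exists (v - u).
apply/subsetP => -[u' v']; move: uv_A; rewrite !inE /= => /eqP <- /eqP.
by move/Phi_fact ->.
Qed.

(** * Walsh transforms *)

(** The sign does not depend on u, and one form [Q] gives the duals of all components t P. Its entry
    through Q / t is what makes inversion the permutation of F_r^* in the dual-bent property. *)
Definition Walsh_pair (p n : nat) (Fr Fn : finFieldType) (P Q : Fn -> Fr) (e : Fr -> bool) : Prop :=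
  forall t, t != 0 -> forall u,
    \sum_x psi (tr1 p (t * P x) - tr1 p (u * x)) =
    (-1) ^+ e t * p%:R ^+ n./2 * psi (- tr1 p (Q u / t)).

Section WalshPairs.

Variables (p n s : nat) (Fr Fn : finFieldType).
Hypotheses (p_pr : prime p) (cardFr : #|Fr| = (p ^ s)%N) (cardFn : #|Fn| = (p ^ n)%N).
Hypothesis n_even : ~~ odd n.

Lemma p_natr_neq0 i : p%:R ^+ i != 0 :> algC.
Proof. by rewrite expf_neq0 // pnatr_eq0 -lt0n prime_gt0. Qed.

Lemma sqr_half_power : p%:R ^+ n./2 * p%:R ^+ n./2 = #|Fn|%:R :> algC.
Proof. by rewrite cardFn natrX -exprD addnn even_halfK. Qed.

(** Fourier inversion applied to the transform of tau P for tau = -1 / t, since then -Q / tau = t Q.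
    Inversion leads to P (- x), which is why P has to be even. *)
Lemma Walsh_pair_sym (P Q : Fn -> Fr) e : (forall x, P (- x) = P x) ->
  Walsh_pair p n P Q e -> Walsh_pair p n Q P (fun t => e (- t^-1)).
Proof.
move=> P_even PQ t t_nz x; set tau := - t^-1.
have tau_nz : tau != 0 by rewrite oppr_eq0 invr_eq0.
have tau_inv : tau^-1 = - t by rewrite invrN invrK.
set c := (-1) ^+ e tau; set C := p%:R ^+ n./2.
have cc : c * c = 1 by rewrite -expr2 sqrr_sign.
set S := \sum_u _.
(* The factor c * C makes each term psi (Tr (t Q u)) the Walsh sum of tau P at u; summing over u
   then leaves only y = - x. *)
have step : c * C * S = #|Fn|%:R * psi (- tr1 p (P x / t)).
  transitivity (\sum_u \sum_y psi (tr1 p (tau * P y)) * psi (tr1 p ((- y - x) * u))).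
    rewrite mulr_sumr; apply: eq_bigr => u _.
    have := PQ tau tau_nz u; rewrite tau_inv mulrN (tr1N p_pr cardFr) opprK [Q u * t]mulrC.
    rewrite psiD // [in RHS]/= mulrA => <-; rewrite mulr_suml; apply: eq_bigr => y _.
    rewrite psiD // -mulrA; congr (_ * _); rewrite -psiD //.
    by rewrite mulrBl mulNr (tr1_additive p_pr cardFn) (tr1N p_pr cardFn) [y * u]mulrC.
  rewrite exchange_big /=; under eq_bigr do rewrite -mulr_sumr (sum_psi_all p_pr cardFn).
  rewrite (bigD1 (- x) isT) big1 /=; last first.
    move=> y y_x; rewrite ifN ?mulr0 // subr_eq0.
    by apply: contraNneq y_x => <-; rewrite opprK.
  rewrite opprK subrr eqxx addr0 P_even mulrC; congr (_ * psi _).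
  by rewrite /tau mulNr (tr1N p_pr cardFr) mulrC.
have C_nz : C != 0 := p_natr_neq0 _.
apply: (mulfI C_nz); rewrite -[LHS]mul1r -cc.
have -> : c * c * (C * S) = c * (c * C * S) by ring.
by rewrite step -sqr_half_power -/C; ring.
Qed.

End WalshPairs.

(** * Character sums of H over the points with z in a given set *)

Section MaioranaMcFarland.

Variables (p n k s : nat) (Fr Fq Fn : finFieldType) (iota : {rmorphism Fr -> Fq}).
Hypotheses (p_pr : prime p) (s_dvd_k : (s %| k)%N).
Hypotheses (cardFr : #|Fr| = (p ^ s)%N) (cardFq : #|Fq| = (p ^ k)%N) (cardFn : #|Fn| = (p ^ n)%N).
Hypothesis n_even : ~~ odd n.

Local Notation V := (Fn * Fq * Fq)%type.
Local Notation form := (@V_form Fn Fq p).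

Lemma V_form_additive_r (xi : V) : zmod_morphism (form xi).
Proof.
move=> [[x1 y1] z1] [[x2 y2] z2]; rewrite /V_form /= !mulrBr.
by rewrite (tr1_additive p_pr cardFn) !(tr1_additive p_pr cardFq); ring.
Qed.

Lemma V_formC (xi x : V) : form xi x = form x xi.
Proof. by rewrite /V_form mulrC [xi.1.2 * _]mulrC [xi.2 * _]mulrC. Qed.

Lemma V_form_additive_l (x : V) : zmod_morphism (form^~ x).
Proof. by move=> a b; rewrite ![form _ x]V_formC V_form_additive_r. Qed.

Lemma V_form_nondegenerate (x : V) : (forall xi, form xi x = 0) -> x = 0.
Proof.
case: x => [[x y] z] form0; have tr0 := (tr1_0 p_pr cardFn, tr1_0 p_pr cardFq).
have x0 : x = 0.
  apply: (tr1_nondegenerate p_pr cardFn) => u; have := form0 (u, 0, 0).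
  by rewrite /V_form /= !mul0r !tr0 !addr0 mulrC.
have y0 : y = 0.
  apply: (tr1_nondegenerate p_pr cardFq) => v; have := form0 (0, v, 0).
  by rewrite /V_form /= !mul0r !tr0 addr0 add0r mulrC.
have z0 : z = 0.
  apply: (tr1_nondegenerate p_pr cardFq) => w; have := form0 (0, 0, w).
  by rewrite /V_form /= !mul0r !tr0 !add0r mulrC.
by rewrite x0 y0 z0.
Qed.

Lemma sum_V (A : {pred Fq}) (f : V -> algC) :
  \sum_(v | v.2 \in A) f v = \sum_(z in A) \sum_x \sum_y f (x, y, z).
Proof.
under [RHS]eq_bigr do rewrite pair_bigA; rewrite pair_big_dep /=.
rewrite (reindex (fun v : V => (v.2, v.1))) /=; last first.
  by exists (fun v : Fq * (Fn * Fq) => (v.2, v.1)) => [] [].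
by apply: eq_big => [[[x y] z] | [[x y] z] _] //=; rewrite andbT.
Qed.

Lemma sum_psi_form (A : {pred Fq}) (xi : V) :
  \sum_(v | v.2 \in A) psi (- form xi v) =
    if (xi.1.1 == 0) && (xi.1.2 == 0)
    then #|Fn|%:R * #|Fq|%:R * \sum_(z in A) psi (- tr1 p (xi.2 * z)) else 0.
Proof.
rewrite sum_V; case: xi => [[u v] w] /=.
transitivity (\sum_(z in A) (\sum_x psi (tr1 p (- u * x))) *
                ((\sum_y psi (tr1 p (- v * y))) * psi (- tr1 p (w * z)))).
  apply: eq_bigr => z _; rewrite mulr_suml; apply: eq_bigr => x _.
  rewrite mulr_suml mulr_sumr; apply: eq_bigr => y _.
  rewrite -!psiD // /V_form /= !mulNr (tr1N p_pr cardFn) (tr1N p_pr cardFq).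
  by congr psi; ring.
rewrite -!mulr_sumr (sum_psi_all p_pr cardFn) (sum_psi_all p_pr cardFq) !oppr_eq0.
by do 2!case: eqP => _ /=; rewrite ?mul0r ?mulr0 ?mulrA.
Qed.

Variables (P Q : Fq -> Fn -> Fr) (e : Fq -> Fr -> bool).
Hypothesis PQ : forall z, Walsh_pair p n (P z) (Q z) (e z).
Hypothesis Q_dep : forall z z', (z == 0) = (z' == 0) -> Q z =1 Q z'.
Hypothesis e_dep : forall z z', (z == 0) = (z' == 0) -> e z =1 e z'.

Let H := H_of iota P.

Definition H_dual (xi : V) : Fr := Q xi.1.2 xi.1.1 + tr iota (xi.1.2 * xi.2).

(** The sum over y vanishes unless z = v / t. As [A] is stable under nonzero scalars from F_r, this
    z lies in [A] exactly when v does, and [Q_dep] and [e_dep] let v replace v / t in the dual form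
    and in the sign. *)
Lemma sum_psi_H (A : {pred Fq}) (t : Fr) (xi : V) :
    t != 0 -> (forall a z, a != 0 -> (iota a * z \in A) = (z \in A)) ->
  \sum_(v | v.2 \in A) psi (tr1 p (t * H v) - form xi v) =
    if xi.1.2 \in A
    then #|Fq|%:R * ((-1) ^+ e xi.1.2 t * p%:R ^+ n./2) * psi (- tr1 p (H_dual xi / t))
    else 0.
Proof.
move=> t_nz A_scale; rewrite sum_V; case: xi => [[u v] w]; rewrite /H_dual /=.
have it_nz : iota t != 0 by rewrite fmorph_eq0.
pose z0 := iota t^-1 * v.
transitivity (\sum_(z in A) (if z == z0 then #|Fq|%:R else 0) *
   ((\sum_x psi (tr1 p (t * P z x) - tr1 p (u * x))) * psi (- tr1 p (w * z)))).
  apply: eq_bigr => z _.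
  have -> : (if z == z0 then #|Fq|%:R else 0) = \sum_y psi (tr1 p ((iota t * z - v) * y)).
    rewrite (sum_psi_all p_pr cardFq); congr (if _ then _ else _).
    rewrite subr_eq0 /z0 fmorphV; apply/eqP/eqP => [-> | <-]; first by rewrite mulVKf.
    by rewrite mulKf.
  rewrite mulrCA [X in _ = _ * X]mulrC mulr_suml; apply: eq_bigr => x _.
  rewrite !mulr_sumr; apply: eq_bigr => y _.
  rewrite -!psiD // /H /H_of /V_form /=; congr psi.
  rewrite mulrDr (tr1D p_pr cardFr) -(tr_scale iota cardFr cardFq s_dvd_k).
  rewrite (tr1_tr p_pr iota cardFr cardFq s_dvd_k) mulrBl (tr1_additive p_pr cardFq).
  have -> : iota t * (y * z) = iota t * z * y by ring.
  ring.
have z0A : (z0 \in A) = (v \in A) by rewrite /z0 A_scale // invr_eq0.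
rewrite big_mkcond (bigD1 z0 isT) [X in _ + X = _]big1 /=; last first.
  by move=> z /negPf ->; rewrite mul0r if_same.
rewrite addr0 eqxx z0A; case: ifP => // _.
have z0v : (z0 == 0) = (v == 0).
  by rewrite /z0 mulf_eq0 fmorph_eq0 invr_eq0 (negPf t_nz).
rewrite (PQ z0 t_nz) (e_dep z0v) (Q_dep z0v) -!mulrA; do 3!congr (_ * _).
rewrite -psiD // mulrDl (tr1D p_pr cardFr) opprD; congr (psi (_ - _)).
rewrite [_ / t in RHS]mulrC -(tr_scale iota cardFr cardFq s_dvd_k).
by rewrite (tr1_tr p_pr iota cardFr cardFq s_dvd_k) /z0; congr tr1; ring.
Qed.

End MaioranaMcFarland.

(** * Level sets of the labels *)

Lemma card_sum_set (A1 A2 : finType) (S : {set A1 + A2}) :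
  #|S| = (#|[set x | inl x \in S]| + #|[set x | inr x \in S]|)%N.
Proof.
rewrite -sum1_card big_mkcond big_sumType /= -!big_mkcond /= !sum1_card.
by congr (_ + _)%N; apply: eq_card => x; rewrite !inE.
Qed.

Section Levels.

Variables (p n k s s' : nat) (Fr Fq Fn Fr' : finFieldType).
Variables (iota : {rmorphism Fr -> Fq}) (iota' : {rmorphism Fr' -> Fr}).
Hypotheses (p_pr : prime p) (s_dvd_k : (s %| k)%N) (s'_dvd_s : (s' %| s)%N).
Hypotheses (cardFr : #|Fr| = (p ^ s)%N) (cardFq : #|Fq| = (p ^ k)%N) (cardFn : #|Fn| = (p ^ n)%N).
Hypothesis cardFr' : #|Fr'| = (p ^ s')%N.

Local Notation V := (Fn * Fq * Fq)%type.
Local Notation form := (@V_form Fn Fq p).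

Section Labels.

Variables (L1 L2 : finType) (kappa : Fq -> L1) (lambda : Fq -> L2).
Variables (P : Fq -> Fn -> Fr) (gamma : Fr).

Definition trace_H (v : V) : Fr' := tr iota' (gamma * H_of iota P v).

(** Three strata: z <> 0, then z = 0 with x <> 0, then the points (0, y, 0). On the middle stratum H
    is P^(0)(x), so its levels are the cells e_i. Lines as [kappa] and [lambda] give Omega_s(H);
    membership in K0 and in its orthogonal gives Omega(H, K0). *)
Definition label (v : V) : (L1 * Fr' + Fr') + L2 :=
  if v.2 != 0 then inl (inl (kappa v.2, trace_H v))
  else if v.1.1 != 0 then inl (inr (trace_H v)) else inr (lambda v.1.2).

Hypothesis gamma_nz : gamma != 0.

Lemma H_of_z0 x y : H_of iota P (x, y, 0) = P 0 x.
Proof. by rewrite /H_of /= mulr0 (tr_0 p_pr iota cardFr cardFq s_dvd_k) addr0. Qed.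

Lemma H_of_surj z x c : z != 0 -> exists y, H_of iota P (x, y, z) = c.
Proof.
move=> z_nz; have [y yE] := tr_surj p_pr iota cardFr cardFq s_dvd_k (c - P z x).
by exists (y / z); rewrite /H_of /= divfK // yE addrC subrK.
Qed.

Lemma trace_H_surj z x j : z != 0 -> exists y, trace_H (x, y, z) = j.
Proof.
move=> z_nz; have [c cE] := tr_surj p_pr iota' cardFr' cardFr s'_dvd_s j.
have [y yE] := H_of_surj x (gamma^-1 * c) z_nz.
by exists y; rewrite /trace_H yE mulVKf.
Qed.

(** On the first stratum y moves H through all values independently of z, so [E], the values of the
    form at z = 0 on nonzero x, is the only part of the image that depends on P. *)
Lemma label_image (E : {set Fr'}) :
    (forall j, reflect (exists2 x, x != 0 & tr iota' (gamma * P 0 x) = j) (j \in E)) ->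
  label @: [set: V] =
    [set l | match l with
             | inl (inl aj) => aj.1 \in kappa @: [set~ 0]
             | inl (inr j) => j \in E
             | inr b => b \in lambda @: [set: Fq]
             end].
Proof.
move=> E_P; apply/setP => l; rewrite inE; apply/imsetP/idP.
  case=> [[[x y] z] _ ->]; rewrite /label /=; case: ifPn => [z_nz | /negPn/eqP ->].
    by apply: imset_f; rewrite !inE.
  case: ifPn => [x_nz | _]; last exact: imset_f.
  by apply/E_P; exists x; rewrite // /trace_H H_of_z0.
case: l => [[[a j] /= /imsetP[z] | j /E_P[x x_nz xE]] | b /imsetP[y _ ->]].
- rewrite !inE => z_nz ->; have [y yE] := trace_H_surj 0 j z_nz.
  by exists (0, y, z); rewrite ?inE // /label /= ifT ?yE.
- by exists (x, 0, 0); rewrite // /label /= eqxx x_nz /trace_H H_of_z0 xE.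
- by exists (0, y, 0); rewrite // /label /= !eqxx.
Qed.

Lemma card_label_image (E : {set Fr'}) :
    (forall j, reflect (exists2 x, x != 0 & tr iota' (gamma * P 0 x) = j) (j \in E)) ->
  #|label @: [set: V]| =
    (#|kappa @: [set~ (0%R : Fq)]| * p ^ s' + #|E| + #|lambda @: [set: Fq]|)%N.
Proof.
move=> E_P; rewrite (label_image E_P) !card_sum_set; congr (_ + _ + _)%N.
- rewrite -cardFr' -cardsT -cardsX; apply: eq_card => -[a j].
  by rewrite !inE andbT.
- by apply: eq_card => j; rewrite !inE.
- by apply: eq_card => b; rewrite !inE.
Qed.

Hypothesis P_even : forall z x, P (- z) (- x) = P z x.
Hypothesis kappaN : forall z, kappa (- z) = kappa z.
Hypothesis lambdaN : forall z, lambda (- z) = lambda z.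
Hypothesis lambda0 : forall y, lambda y = lambda 0 -> y = 0.

Lemma H_ofN v : H_of iota P (- v) = H_of iota P v.
Proof. by rewrite /H_of /= P_even mulrNN. Qed.

Lemma labelN v : label (- v) = label v.
Proof. by rewrite /label /trace_H H_ofN /= !oppr_eq0 kappaN lambdaN. Qed.

Lemma label0 v : label v = label 0 -> v = 0.
Proof.
case: v => [[x y] z]; rewrite /label /= !eqxx /=.
by case: (z =P 0) => // ->; case: (x =P 0) => // -> [/lambda0 ->].
Qed.

End Labels.

Variables (P Q : Fq -> Fn -> Fr) (e : Fq -> Fr -> bool).
Hypothesis n_even : ~~ odd n.
Hypothesis PQ : forall z, Walsh_pair p n (P z) (Q z) (e z).
Hypothesis Q_dep : forall z z', (z == 0) = (z' == 0) -> Q z =1 Q z'.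
Hypothesis e_dep : forall z z', (z == 0) = (z' == 0) -> e z =1 e z'.
Hypothesis P00 : P 0 0 = 0.
Hypothesis Q00 : Q 0 0 = 0.

Variable gamma : Fr.
Hypothesis gamma_nz : gamma != 0.

Local Notation Hg := (trace_H P gamma).

(** The factor gamma^-1 appears because the dual of the component t gamma is the trace of - [H_dual]
    / (t gamma). *)
Definition trace_H_dual (xi : V) : Fr' := tr iota' (gamma^-1 * H_dual iota Q xi).

(** The condition that the value is j is expanded in the additive characters of F_r'. The term t = 0
    is the plain sum over [A]; the others are Walsh sums of the components iota' t * gamma. Thus xi
    enters the latter only through v and [trace_H_dual xi]. *)
Lemma sum_level (A : {pred Fq}) (j : Fr') (xi : V) :
    (forall a z, a != 0 -> (iota a * z \in A) = (z \in A)) ->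
  #|Fr'|%:R * \sum_(v | (v.2 \in A) && (Hg v == j)) psi (- form xi v) =
  \sum_(v | v.2 \in A) psi (- form xi v) +
  if xi.1.2 \in A then
    \sum_(t : Fr' | t != 0) psi (- tr1 p (t * j)) *
      (#|Fq|%:R * ((-1) ^+ e xi.1.2 (iota' t * gamma) * p%:R ^+ n./2) *
       psi (- tr1 p (t^-1 * trace_H_dual xi)))
  else 0.
Proof.
move=> A_scale.
transitivity (\sum_(t : Fr') psi (- tr1 p (t * j)) *
    \sum_(v | v.2 \in A) psi (tr1 p (iota' t * gamma * H_of iota P v) - form xi v)).
  under [RHS]eq_bigr do rewrite mulr_sumr; rewrite exchange_big /=.
  rewrite mulr_sumr [LHS]big_mkcondr /=; apply: eq_bigr => v _.
  transitivity (psi (- form xi v) * \sum_t psi (tr1 p ((Hg v - j) * t))).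
    by rewrite (sum_psi_all p_pr cardFr') subr_eq0; case: eqP => _; rewrite ?mulr0 // mulrC.
  rewrite mulr_sumr; apply: eq_bigr => t _; rewrite -!psiD //; congr psi.
  rewrite mulrBl (tr1_additive p_pr cardFr') [j * t]mulrC [Hg v * t]mulrC.
  rewrite -(tr_scale iota' cardFr' cardFr s'_dvd_s) (tr1_tr p_pr iota' cardFr' cardFr s'_dvd_s).
  by rewrite mulrA; ring.
rewrite (bigD1 0 isT) /=; congr (_ + _).
  rewrite !mul0r (tr1_0 p_pr cardFr') oppr0 psi0 mul1r; apply: eq_bigr => v _.
  by rewrite rmorph0 !mul0r (tr1_0 p_pr cardFr) add0r.
have step (t : Fr') : t != 0 ->
   \sum_(v | v.2 \in A) psi (tr1 p (iota' t * gamma * H_of iota P v) - form xi v) =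
   if xi.1.2 \in A then #|Fq|%:R * ((-1) ^+ e xi.1.2 (iota' t * gamma) * p%:R ^+ n./2) *
       psi (- tr1 p (t^-1 * trace_H_dual xi)) else 0.
  move=> t_nz; have T_nz : iota' t * gamma != 0 by rewrite mulf_neq0 ?fmorph_eq0.
  rewrite (sum_psi_H p_pr s_dvd_k cardFr cardFq PQ Q_dep e_dep xi T_nz A_scale).
  case: ifP => // _; congr (_ * psi (- _)).
  rewrite -(tr_scale iota' cardFr' cardFr s'_dvd_s) (tr1_tr p_pr iota' cardFr' cardFr s'_dvd_s).
  by rewrite fmorphV mulrC invfM mulrA.
under eq_bigr => t t_nz do rewrite step //.
by case: ifP => _ //; rewrite big1 // => t _; rewrite mulr0.
Qed.

Lemma sum_level_eq (A : {pred Fq}) (j : Fr') (xi eta : V) :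
    (forall a z, a != 0 -> (iota a * z \in A) = (z \in A)) ->
    \sum_(v | v.2 \in A) psi (- form xi v) = \sum_(v | v.2 \in A) psi (- form eta v) ->
    (xi.1.2 \in A) = (eta.1.2 \in A) ->
    (xi.1.2 \in A -> (xi.1.2 == 0) = (eta.1.2 == 0) /\ trace_H_dual xi = trace_H_dual eta) ->
  \sum_(v | (v.2 \in A) && (Hg v == j)) psi (- form xi v) =
  \sum_(v | (v.2 \in A) && (Hg v == j)) psi (- form eta v).
Proof.
move=> A_scale sumA inA dualA.
have r_nz : #|Fr'|%:R != 0 :> algC by rewrite cardFr' natrX p_natr_neq0.
apply: (mulfI r_nz); rewrite !sum_level // sumA -inA; congr (_ + _).
case: ifP => // xiA; have [xi0 ->] := dualA xiA.
by apply: eq_bigr => t _; rewrite (e_dep xi0).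
Qed.

Variables (L1 L2 : finType) (kappa : Fq -> L1) (lambda : Fq -> L2).
Hypothesis kappa_scale : forall a z, a != 0 -> kappa (iota a * z) = kappa z.
Hypothesis kappa_sums : forall l w w', lambda w = lambda w' ->
  \sum_(z | (z != 0) && (kappa z == l)) psi (- tr1 p (w * z)) =
  \sum_(z | (z != 0) && (kappa z == l)) psi (- tr1 p (w' * z)).
Hypothesis lambda_sums : forall l v v', kappa v = kappa v' ->
  \sum_(y | lambda y == l) psi (- tr1 p (v * y)) =
  \sum_(y | lambda y == l) psi (- tr1 p (v' * y)).

Let Phi := label kappa lambda P gamma.

Definition dual_label (xi : V) : (L1 * Fr' + Fr') + L2 :=
  if xi.1.2 != 0 then inl (inl (kappa xi.1.2, trace_H_dual xi))
  else if xi.1.1 != 0 then inl (inr (trace_H_dual xi)) else inr (lambda xi.2).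

Lemma dual_labelE xi :
  dual_label xi = label kappa lambda Q gamma^-1 (xi.1.1, xi.2, xi.1.2).
Proof.
rewrite /dual_label /label /trace_H /trace_H_dual /H_dual /H_of /=.
by rewrite [xi.2 * _]mulrC.
Qed.

Lemma sum_xz0 (f : V -> algC) (R : pred Fq) :
  \sum_(v | [&& v.2 == 0, v.1.1 == 0 & R v.1.2]) f v = \sum_(y | R y) f (0, y, 0).
Proof.
rewrite (reindex_onto (fun y => (0, y, 0) : V) (fun v => v.1.2)) /=; last first.
  by move=> [[x y] z] /= /and3P[/eqP-> /eqP-> _].
by apply: eq_bigl => y; rewrite !eqxx andbT.
Qed.

(** Cells with z <> 0 are covered by [sum_level_eq] with [kappa_sums], cells of points (0, y, 0) by
    [lambda_sums]. The cells e_i are differences of sums of these two kinds. *)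
Lemma dual_label_sums xi eta : dual_label xi = dual_label eta ->
  forall l, character_sum form xi (level Phi l) = character_sum form eta (level Phi l).
Proof.
move=> dual_eq l.
have csE zeta' S : character_sum form zeta' S = \sum_(v in S) psi (- form zeta' v) by [].
rewrite !csE.
have v_eq0 : (xi.1.2 == 0) = (eta.1.2 == 0).
  by move: dual_eq; rewrite /dual_label; do 4!case: eqP => _ //=.
have v_kappa : kappa xi.1.2 = kappa eta.1.2.
  move: dual_eq; rewrite /dual_label -v_eq0; case: eqP => [x0 | _] /=; last by case.
  by move: v_eq0; rewrite x0 eqxx => /esym/eqP ->.
have v_u : (xi.1.1 == 0) && (xi.1.2 == 0) = (eta.1.1 == 0) && (eta.1.2 == 0).
  move: dual_eq; rewrite /dual_label -v_eq0 !(andbC (_.1.1 == 0)); case: eqP => //= _.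
  by do 2!case: eqP.
have v_dual : trace_H_dual xi = trace_H_dual eta.
  case u0 : ((xi.1.1 == 0) && (xi.1.2 == 0)); last first.
    move: dual_eq u0; rewrite /dual_label -v_eq0; case: eqP => _ /=; last by move=> [].
    rewrite andbT => + u0; rewrite u0 /=; case: eqP => //= _ [] //.
  (* On the third stratum the dual label does not contain the value of the dual of H, but there this
     value is 0. *)
  have dual0 (zeta' : V) : (zeta'.1.1 == 0) && (zeta'.1.2 == 0) -> trace_H_dual zeta' = 0.
    case: zeta' => [[u v] w] /= /andP[/eqP -> /eqP ->].
    rewrite /trace_H_dual /H_dual /= Q00 mul0r (tr_0 p_pr iota cardFr cardFq s_dvd_k) addr0.
    by rewrite mulr0 (tr_0 p_pr iota' cardFr' cardFr s'_dvd_s).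
  by rewrite !dual0 // -v_u.
have v_lambda : (xi.1.1 == 0) && (xi.1.2 == 0) -> lambda xi.2 = lambda eta.2.
  move=> u0; move: (u0); rewrite v_u => /andP[u0' v0'].
  move: u0 dual_eq; rewrite /dual_label u0' v0' => /andP[-> ->] /=; by case.
have sumA (A : {pred Fq}) :
    (forall w w', lambda w = lambda w' ->
       \sum_(z in A) psi (- tr1 p (w * z)) = \sum_(z in A) psi (- tr1 p (w' * z))) ->
    \sum_(v | v.2 \in A) psi (- form xi v) = \sum_(v | v.2 \in A) psi (- form eta v).
  move=> A_lambda; rewrite !(sum_psi_form p_pr cardFq cardFn) -v_u.
  by case: ifP => // /v_lambda /A_lambda ->.
have sum_level0 j : \sum_(v | (v.2 \in pred1 0) && (Hg v == j)) psi (- form xi v) =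
    \sum_(v | (v.2 \in pred1 0) && (Hg v == j)) psi (- form eta v).
  apply: sum_level_eq => //.
  - by move=> a z a_nz; rewrite !inE mulf_eq0 fmorph_eq0 (negPf a_nz).
  - by apply: sumA => w w' _; rewrite !big_pred1_eq !mulr0.
have sum_y0 (R : pred Fq) : (forall v v', kappa v = kappa v' ->
      \sum_(y | R y) psi (- tr1 p (v * y)) = \sum_(y | R y) psi (- tr1 p (v' * y))) ->
    \sum_(v | [&& v.2 == 0, v.1.1 == 0 & R v.1.2]) psi (- form xi v) =
    \sum_(v | [&& v.2 == 0, v.1.1 == 0 & R v.1.2]) psi (- form eta v).
  have formE (zeta' : V) y : form zeta' (0, y, 0) = tr1 p (zeta'.1.2 * y).
    by rewrite /V_form /= !mulr0 (tr1_0 p_pr cardFn) (tr1_0 p_pr cardFq) add0r addr0.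
  move=> R_kappa; rewrite !sum_xz0; under eq_bigr do rewrite formE.
  by under [RHS]eq_bigr do rewrite formE; apply: R_kappa.
case: l => [[[a j] | j] | b].
- pose A := [pred z : Fq | (z != 0) && (kappa z == a)].
  have levelE v : (v \in level Phi (inl (inl (a, j)))) = (v.2 \in A) && (Hg v == j).
    rewrite !inE /Phi /label; case: ifP => _ /=; last by case: ifP.
    by [].
  rewrite !(eq_bigl _ _ levelE); apply: sum_level_eq.
  + move=> c z c_nz; rewrite !inE mulf_eq0 fmorph_eq0 (negPf c_nz) kappa_scale //.
  + exact/sumA/kappa_sums.
  + by rewrite !inE v_eq0 v_kappa.
  + by [].
- have levelE v : (v \in level Phi (inl (inr j))) =
      ((v.2 \in pred1 0) && (Hg v == j)) && (v.1.1 != 0).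
    rewrite !inE /Phi /label; by case: (v.2 == 0); case: (v.1.1 == 0); rewrite ?andbF ?andbT.
  rewrite !(eq_bigl _ _ levelE).
  (* The condition x <> 0 is not of the kind treated by [sum_level]. The sum is taken over all x at
     z = 0, and the part with x = 0 is subtracted; as P 0 0 = 0, that part is empty unless j = 0. *)
  have := sum_level0 j; rewrite [LHS](bigID (fun v => v.1.1 != 0))
    [RHS](bigID (fun v => v.1.1 != 0)) /=.
  have splitE (zeta' : V) :
     \sum_(v : V | (v.2 \in pred1 0) && (Hg v == j) && ~~ (v.1.1 != 0)) psi (- form zeta' v) =
     \sum_(v : V | [&& v.2 == 0, v.1.1 == 0 & (fun=> j == 0) v.1.2]) psi (- form zeta' v).
    apply: eq_bigl => -[[x y] z]; rewrite !inE negbK /=; case: eqP => //= ->.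
    case: (x =P 0) => [-> | _]; rewrite ?andbF // andbT /trace_H H_of_z0 P00 mulr0.
    by rewrite (tr_0 p_pr iota' cardFr' cardFr s'_dvd_s) eq_sym.
  rewrite !splitE (sum_y0 (fun=> j == 0)); first exact: addIr.
  (* For j = 0 all y occur, and they are grouped by [lambda]. *)
  move=> v v' vv'; case: (j == 0); last by rewrite !big_pred0_eq.
  rewrite (partition_big lambda predT) // [RHS](partition_big lambda predT) //=.
  by apply: eq_bigr => l _; apply: lambda_sums.
- have levelE v : (v \in level Phi (inr b)) = [&& v.2 == 0, v.1.1 == 0 & lambda v.1.2 == b].
    by rewrite !inE /Phi /label; case: (v.2 == 0); case: (v.1.1 == 0).
  rewrite !(eq_bigl _ _ levelE); apply: (sum_y0 (fun y => lambda y == b)).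
  exact: lambda_sums.
Qed.

Hypothesis P_even : forall z x, P (- z) (- x) = P z x.
Hypothesis kappaN : forall z, kappa (- z) = kappa z.
Hypothesis lambdaN : forall z, lambda (- z) = lambda z.
Hypothesis lambda0 : forall y, lambda y = lambda 0 -> y = 0.

Variable E : {set Fr'}.
Hypothesis E_P : forall j, reflect (exists2 x, x != 0 & tr iota' (gamma * P 0 x) = j) (j \in E).
Hypothesis E_Q : forall j, reflect (exists2 x, x != 0 & tr iota' (gamma^-1 * Q 0 x) = j) (j \in E).

(** The dual label is a label of the same shape for Q and gamma^-1, with y and z exchanged. [E_P]
    and [E_Q] share the set [E], so both labels have the same possible values. *)
Lemma dual_label_card : (#|dual_label @: [set: V]| <= #|Phi @: [set: V]|)%N.
Proof.
rewrite /Phi (label_image kappa lambda gamma_nz E_P).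
have gV_nz : gamma^-1 != 0 by rewrite invr_eq0.
rewrite -(label_image kappa lambda gV_nz E_Q).
apply/subset_leq_card/subsetP => _ /imsetP[xi _ ->]; rewrite dual_labelE; exact: imset_f.
Qed.

Lemma label_scheme d :
  (#|kappa @: [set~ (0%R : Fq)]| * p ^ s' + #|E| + #|lambda @: [set: Fq]|)%N = d.+1 ->
  symmetric_scheme d (relations (preim_partition Phi [set: V])).
Proof.
rewrite -(card_label_image kappa lambda gamma_nz E_P) => card_d.
apply: (level_symmetric_scheme p_pr (V_form_additive_l p_pr cardFq cardFn)
  (V_form_additive_r p_pr cardFq cardFn) (V_form_nondegenerate p_pr cardFq cardFn)
  dual_label_sums dual_label_card _ _ card_d) => [v | v].
- exact: label0.
- exact: labelN.
Qed.

Lemma label_reflexive : Fourier_reflexive form (preim_partition Phi [set: V]).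
Proof.
apply: (level_Fourier_reflexive p_pr (V_form_additive_l p_pr cardFq cardFn)
  (V_form_additive_r p_pr cardFq cardFn) (V_form_nondegenerate p_pr cardFq cardFn)
  dual_label_sums dual_label_card) => v; exact: label0.
Qed.

End Levels.

(** * Gauss sums *)

Section OddFiniteField.

Variables (p n : nat) (E : finFieldType).
Hypotheses (p_pr : prime p) (p_odd : odd p) (cardE : #|E| = (p ^ n)%N).

Lemma two_neq0 : 2 != 0 :> E.
Proof.
have pE := card_finPcharP cardE p_pr.
rewrite -(dvdn_pcharf pE); apply/negP => /dvdn_leq -/(_ isT) p_le2.
by have := prime_gt1 p_pr; lia.
Qed.

Lemma four_neq0 : 4 != 0 :> E.
Proof. by rewrite (natrM E 2 2) mulf_neq0 ?two_neq0. Qed.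

Lemma expf_card_pred (x : E) : x != 0 -> x ^+ #|E|.-1 = 1.
Proof.
move=> x_nz; apply: (mulfI x_nz); rewrite mulr1 -exprS prednK ?expf_card //.
by apply/card_gt0P; exists 0.
Qed.

Lemma half_card_pred : (#|E|.-1./2 * 2)%N = #|E|.-1.
Proof.
rewrite muln2 even_halfK // -oddS prednK; last by apply/card_gt0P; exists 0.
by rewrite cardE oddX p_odd orbT.
Qed.

(** For x = g^i with g a generator of the multiplicative group, of order N, the hypothesis says that
    N divides i N / 2, so i is even. *)
Lemma Euler_square (x : E) : x != 0 -> x ^+ #|E|.-1./2 = 1 -> exists y, y ^+ 2 = x.
Proof.
move=> x_nz x_half; set N := #|E|.-1.
have N_gt0 : (0 < N)%N by have := finNzRing_gt1 E; rewrite /N; case: #|E| => [|[]].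
have : has N.-primitive_root (enum [pred z : E | z != 0]).
  apply: has_prim_root => //.
  - by apply/allP => z; rewrite mem_enum inE => /expf_card_pred zN; apply/unity_rootP.
  - exact: enum_uniq.
  - rewrite /N -(cardC1 (0 : E)) fintype.cardE -!fintype.cardE; apply: eq_leq; by apply: eq_card.
case/hasP => g _ g_prim; have [i xE] := prim_rootP g_prim (expf_card_pred x_nz).
have /eqP := x_half; rewrite xE -exprM -(prim_order_dvd g_prim)
  -[X in (X %| _)%N]half_card_pred mulnC.
rewrite dvdn_pmul2r; last by have := half_card_pred; rewrite -/N; lia.
by case/dvdnP => j ->; exists (g ^+ j); rewrite exprM.
Qed.

Lemma nonsquare_half (a : E) : a != 0 -> (forall y, y ^+ 2 != a) -> a ^+ #|E|.-1./2 = -1.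
Proof.
move=> a_nz a_nsq; have := expf_card_pred a_nz; rewrite -{1}half_card_pred exprM.
move/eqP; rewrite sqrf_eq1 => /orP[/eqP a1 | /eqP //].
by have [y /eqP] := Euler_square a_nz a1; rewrite (negPf (a_nsq y)).
Qed.

(** A nonzero y has two roots in exactly one of the two classes, and y = 0 has the root 0 in
    both. *)
Lemma card_square_class (a y : E) : a != 0 -> (forall z, z ^+ 2 != a) ->
  (#|[set x : E | (x ^+ 2 == y)%R]| + #|[set x : E | (a * x ^+ 2 == y)%R]| = 2)%N.
Proof.
move=> a_nz a_nsq; have [-> | y_nz] := eqVneq y 0.
  have -> : [set x : E | x ^+ 2 == 0] = [set 0].
    by apply/setP => x; rewrite !inE sqrf_eq0.
  have -> : [set x : E | a * x ^+ 2 == 0] = [set 0].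
    by apply/setP => x; rewrite !inE mulf_eq0 (negPf a_nz) sqrf_eq0.
  by rewrite !cards1.
have card2 (c : E) : c != 0 -> #|[set x : E | x ^+ 2 == c ^+ 2]| = 2%N.
  move=> c_nz; have -> : [set x : E | x ^+ 2 == c ^+ 2] = [set c; - c].
    by apply/setP => x; rewrite !inE eqf_sqr.
  suff c_neq : c != - c by rewrite cards2 c_neq.
  by rewrite -addr_eq0 -mulr2n -mulr_natl mulf_neq0 ?two_neq0.
case: (pickP (fun c : E => c ^+ 2 == y)) => [c /eqP c_y | y_nsq].
  have c_nz : c != 0 by apply: contraNneq y_nz => c0; rewrite -c_y c0 expr0n.
  rewrite -c_y card2 // -[RHS]addn0; congr (_ + _)%N; apply/eqP.
  rewrite cards_eq0; apply/eqP/setP => x; rewrite !inE; apply/eqP => ax.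
  have x_nz : x != 0.
    by apply: contraNneq y_nz => x0; rewrite -c_y -ax x0 expr0n mulr0.
  by have /eqP := a_nsq (c / x); apply; rewrite expr_div_n -ax mulfK ?expf_neq0.
have [d dE] : exists d, d ^+ 2 = y / a.
  apply: Euler_square; first by rewrite mulf_neq0 ?invr_eq0.
  rewrite expr_div_n !nonsquare_half ?divff ?oppr_eq0 ?oner_eq0 //.
  by move=> z; rewrite y_nsq.
have d_nz : d != 0.
  by apply: contraNneq (mulf_neq0 y_nz (invr_neq0 a_nz)) => d0; rewrite -dE d0 expr0n.
have -> : [set x : E | x ^+ 2 == y] = set0 by apply/setP => x; rewrite !inE y_nsq.
rewrite cards0 add0n -[RHS](card2 d d_nz); apply: eq_card => x; rewrite !inE dE.
by apply/eqP/eqP => [<- | ->]; [rewrite [_ / a]mulrC mulKf | rewrite mulrC divfK].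
Qed.

Lemma sum_square_classes (a : E) (f : E -> algC) : a != 0 -> (forall z, z ^+ 2 != a) ->
  \sum_x f (x ^+ 2) + \sum_x f (a * x ^+ 2) = 2 * \sum_x f x.
Proof.
move=> a_nz a_nsq.
have sumE (h : E -> E) : \sum_x f (h x) = \sum_y #|[set x | h x == y]|%:R * f y.
  rewrite (partition_big h predT) //=; apply: eq_bigr => y _.
  rewrite -sum1_card natr_sum mulr_suml; apply: eq_big => [x | x /eqP ->].
    by rewrite inE.
  by rewrite mul1r.
rewrite (sumE (fun x => x ^+ 2)) (sumE (fun x => a * x ^+ 2)) -big_split /= mulr_sumr.
apply: eq_bigr => y _; by rewrite -mulrDl -natrD card_square_class.
Qed.

Definition Gauss (t : E) : algC := \sum_x psi (tr1 p (t * x ^+ 2)).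

Lemma Gauss_square (t c : E) : c != 0 -> Gauss (t * c ^+ 2) = Gauss t.
Proof.
move=> c_nz; rewrite /Gauss [RHS](reindex_inj (mulfI c_nz)) /=.
by apply: eq_bigr => x _; congr (psi (tr1 p _)); ring.
Qed.

(** With x = a + y one has t (x^2 - y^2) = t a^2 + 2 t a y, and the sum over y keeps only a = 0. *)
Lemma GaussN (t : E) : t != 0 -> Gauss t * Gauss (- t) = #|E|%:R.
Proof.
move=> t_nz; rewrite /Gauss big_distrlr /= exchange_big /=.
transitivity (\sum_(a : E) psi (tr1 p (t * a ^+ 2)) * \sum_y psi (tr1 p (t * a * 2 * y))).
  under [RHS]eq_bigr do rewrite mulr_sumr; rewrite [RHS]exchange_big /=.
  apply: eq_bigr => y _; rewrite (reindex_inj (addIr y)) /=; apply: eq_bigr => a _.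
  by rewrite -!psiD // -!(tr1D p_pr cardE); congr (psi (tr1 _ _)); ring.
rewrite (bigD1 0 isT) [X in _ + X = _]big1 /=; last first.
  move=> a a_nz; rewrite (sum_psi_all p_pr cardE) ifN ?mulr0 //.
  by rewrite !mulf_neq0 ?two_neq0.
by rewrite (sum_psi_all p_pr cardE) expr0n !mulr0 mul0r eqxx (tr1_0 p_pr cardE) psi0 mul1r addr0.
Qed.

Lemma Gauss_nonsquare (a t : E) : a != 0 -> (forall z, z ^+ 2 != a) -> t != 0 ->
  Gauss (a * t) = - Gauss t.
Proof.
move=> a_nz a_nsq t_nz; apply/eqP; rewrite -addr_eq0 addrC; apply/eqP.
have := sum_square_classes (fun y => psi (tr1 p (t * y))) a_nz a_nsq.
rewrite (sum_psi_all p_pr cardE) (negPf t_nz) mulr0 => <-; congr (_ + _).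
by apply: eq_bigr => x _; rewrite mulrA [t * a]mulrC.
Qed.

(** Completing the square: x is shifted by u / (2 t). *)
Lemma sum_psi_quadratic (t u : E) : t != 0 ->
  \sum_x psi (tr1 p (t * x ^+ 2) - tr1 p (u * x)) = Gauss t * psi (- tr1 p (u ^+ 2 / (4 * t))).
Proof.
move=> t_nz; rewrite (reindex_inj (addIr (u / (2 * t)))) /= /Gauss mulr_suml.
apply: eq_bigr => x _; rewrite -psiD // -(tr1_additive p_pr cardE) -(tr1_additive p_pr cardE).
congr (psi (tr1 _ _)); field; by rewrite t_nz two_neq0 four_neq0.
Qed.

(** For even n the order of E is an odd square, hence 1 modulo 4, and Euler's criterion applies to
    -1. *)
Lemma square_minus1 : ~~ odd n -> exists i : E, i ^+ 2 = -1.
Proof.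
move=> n_even; apply: Euler_square; first by rewrite oppr_eq0 oner_eq0.
rewrite -signr_odd; suff -> : odd #|E|.-1./2 = false by [].
have : (#|E| = 1 %[mod 4]).
  rewrite cardE -(even_halfK n_even) -mul2n expnM -modnXm.
  have -> : (p ^ 2 = 1 %[mod 4])%N.
    by rewrite -[p]odd_double_half p_odd; nia.
  by rewrite modnXm exp1n.
have : (0 < #|E|)%N by apply/card_gt0P; exists 0.
lia.
Qed.

End OddFiniteField.

(** * The quadratic forms of the two choices: transforms, values and zeros *)

Section Choices.

Variables (p n s : nat) (Fr Fn : finFieldType) (iota : {rmorphism Fr -> Fn}).
Hypotheses (p_pr : prime p) (p_odd : odd p) (s_dvd_n : (s %| n)%N) (n_even : ~~ odd n).
Hypotheses (cardFr : #|Fr| = (p ^ s)%N) (cardFn : #|Fn| = (p ^ n)%N).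

Lemma Walsh_pair_ext (P P' Q : Fn -> Fr) e :
  P =1 P' -> Walsh_pair p n P Q e -> Walsh_pair p n P' Q e.
Proof.
move=> PP' PQ t t_nz u; rewrite -(PQ t t_nz u); apply: eq_bigr => x _; by rewrite PP'.
Qed.

Lemma Walsh_pair_square (c : Fr) (e : Fr -> bool) :
    c != 0 ->
    (forall t, t != 0 -> Gauss p (iota (c * t)) = (-1) ^+ e t * p%:R ^+ n./2) ->
  Walsh_pair p n (fun x => tr iota (iota c * x ^+ 2))
    (fun u => (4 * c)^-1 * tr iota (u ^+ 2)) e.
Proof.
move=> c_nz e_Gauss t t_nz u; rewrite -e_Gauss //.
have ct_nz : iota (c * t) != 0 by rewrite fmorph_eq0 mulf_neq0.
have -> : - tr1 p ((4 * c)^-1 * tr iota (u ^+ 2) / t) = - tr1 p (u ^+ 2 / (4 * iota (c * t))).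
  have -> : (4 * c)^-1 * tr iota (u ^+ 2) / t = ((4 * c)^-1 / t) * tr iota (u ^+ 2) by ring.
  rewrite -(tr_scale iota cardFr cardFn s_dvd_n) (tr1_tr p_pr iota cardFr cardFn s_dvd_n).
  congr (- tr1 p _); rewrite [RHS]mulrC; congr (_ * _).
  by rewrite -invfM fmorphV -mulrA [iota (4 * _)]rmorphM rmorph_nat.
rewrite -(sum_psi_quadratic p_pr p_odd cardFn) //; apply: eq_bigr => x _.
rewrite -(tr_scale iota cardFr cardFn s_dvd_n) (tr1_tr p_pr iota cardFr cardFn s_dvd_n).
by rewrite mulrA -rmorphM [t * c]mulrC.
Qed.

(** Solutions are counted with the characters of F_r. The transform is needed only at u = 0, where Q
    0 = 0 reduces it to the sign times p^(n/2). *)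
Lemma Walsh_pair_count (P Q : Fn -> Fr) e i : Walsh_pair p n P Q e -> Q 0 = 0 ->
  #|Fr|%:R * #|[set x | P x == i]|%:R =
    #|Fn|%:R + p%:R ^+ n./2 * \sum_(t : Fr | t != 0) (-1) ^+ e t * psi (- tr1 p (t * i)) :> algC.
Proof.
move=> PQ Q0.
transitivity (\sum_(t : Fr) psi (- tr1 p (t * i)) * \sum_x psi (tr1 p (t * P x))).
  under [RHS]eq_bigr do rewrite mulr_sumr; rewrite [RHS]exchange_big /=.
  rewrite -[#|[set _ | _]|]sum1_card natr_sum mulr_sumr [LHS]big_mkcond /=; apply: eq_bigr => x _.
  transitivity (\sum_(t : Fr) psi (tr1 p ((P x - i) * t))).
    by rewrite (sum_psi_all p_pr cardFr) subr_eq0 inE mulr1.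
  apply: eq_bigr => t _; rewrite -[in RHS]psiD // [- _ + _]addrC -(tr1_additive p_pr cardFr).
  by congr (psi (tr1 _ _)); ring.
rewrite (bigD1 0 isT) /=; congr (_ + _).
  rewrite mul0r (tr1_0 p_pr cardFr) oppr0 psi0 mul1r -sum1_card natr_sum.
  by apply: eq_bigr => x _; rewrite mul0r (tr1_0 p_pr cardFr).
rewrite mulr_sumr; apply: eq_bigr => t t_nz.
have := PQ t t_nz 0; rewrite Q0 mul0r (tr1_0 p_pr cardFr) oppr0 psi0 mulr1.
have -> : \sum_x psi (tr1 p (t * P x) - tr1 p (0 * x)) = \sum_x psi (tr1 p (t * P x)).
  by apply: eq_bigr => x _; rewrite mul0r (tr1_0 p_pr cardFn) subr0.
by move=> ->; ring.
Qed.

(** The error term consists of r - 1 summands of absolute value p^(n/2). The bound is written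
    without subtraction to stay in the natural numbers. *)
Lemma Walsh_pair_count_leq (P Q : Fn -> Fr) e i : Walsh_pair p n P Q e -> Q 0 = 0 ->
  (p ^ n <= p ^ s * #|[set x | P x == i]| + (p ^ s).-1 * p ^ n./2)%N.
Proof.
move=> PQ Q0; have := Walsh_pair_count i PQ Q0.
set S := \sum_(_ | _) _ => /esym/(canRL (addrK _)) count.
have S_le : `|S| <= (p ^ s).-1%:R.
  apply: le_trans (ler_norm_sum _ _ _) _.
  rewrite -cardFr -(cardC1 (0 : Fr)) -[#|_|]sum1_card natr_sum le_eqVlt; apply/orP; left; apply/eqP.
  by apply: eq_big => // t t_nz; rewrite normrM normrX normrN1 expr1n norm_psi // mulr1.
rewrite -(ler_nat algC) natrD !natrM -cardFn -cardFr -[leLHS]normr_nat count.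
apply: le_trans (ler_normB _ _) _; rewrite !normrM !normr_nat lerD2l normrX normr_nat.
by rewrite mulrC natrX cardFr ler_wpM2r ?exprn_ge0 ?ler0n.
Qed.

Lemma Walsh_pair_surj (P Q : Fn -> Fr) e i : Walsh_pair p n P Q e -> Q 0 = 0 -> P 0 = 0 ->
  i != 0 -> (s <= n./2)%N -> exists2 x, x != 0 & P x = i.
Proof.
move=> PQ Q0 P0 i_nz s_le.
have := Walsh_pair_count_leq i PQ Q0.
case: (set_0Vmem [set x | P x == i]) => [-> | [x]]; last first.
  rewrite inE => /eqP Pi _; exists x => //; apply: contraNneq i_nz => x0.
  by rewrite -Pi x0 P0.
rewrite cards0 muln0 add0n -{1}(even_halfK n_even) -addnn expnD leq_pmul2r ?expn_gt0 ?prime_gt0 //.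
have : (p ^ s <= p ^ n./2)%N by rewrite leq_exp2l ?prime_gt1.
have : (0 < p ^ s)%N by rewrite expn_gt0 prime_gt0.
lia.
Qed.

(** If 0 were the only zero, the count would give C^2 <= r + (r - 1) C for C = p^(n/2), which fails
    for C > r. *)
Lemma Walsh_pair_isotropic (P Q : Fn -> Fr) e : Walsh_pair p n P Q e -> Q 0 = 0 ->
  (s < n./2)%N -> exists2 x, x != 0 & P x = 0.
Proof.
move=> PQ Q0 s_lt; have := Walsh_pair_count_leq 0 PQ Q0.
case: (pickP [pred x | (x != 0) && (P x == 0)]) => [x /andP[x_nz /eqP Px] _ | no_x].
  by exists x.
have /subset_leq_card : [set x | P x == 0] \subset [set 0].
  apply/subsetP => x; rewrite !inE => Px; apply/negPn/negP => x_nz.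
  by have := no_x x; rewrite /= x_nz Px.
rewrite cards1 -{1}(even_halfK n_even) -addnn expnD.
have : (p ^ s < p ^ n./2)%N by rewrite ltn_exp2l ?prime_gt1.
have : (0 < p ^ s)%N by rewrite expn_gt0 prime_gt0.
nia.
Qed.

(** With all signs -1 and p^(n/2) = r, the count reads r N0 = r^2 - r (r - 1) = r, so P has a single
    zero. *)
Lemma Walsh_pair_anisotropic (P Q : Fn -> Fr) e : Walsh_pair p n P Q e -> Q 0 = 0 ->
  P 0 = 0 -> (forall t, t != 0 -> e t) -> s = n./2 -> forall x, P x = 0 -> x = 0.
Proof.
move=> PQ Q0 P0 e1 s_eq; have := Walsh_pair_count 0 PQ Q0.
have -> : \sum_(t : Fr | t != 0) (-1) ^+ e t * psi (- tr1 p (t * 0)) = - (#|Fr|.-1)%:R :> algC.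
  rewrite -(cardC1 (0 : Fr)) -sum1_card natr_sum -sumrN; apply: eq_big => // t t_nz.
  by rewrite e1 // mulr0 (tr1_0 p_pr cardFr) oppr0 psi0 mulr1 expr1.
rewrite -s_eq -natrX -cardFr mulrN -!natrM.
have -> : #|Fn| = (#|Fr| + #|Fr| * #|Fr|.-1)%N.
  rewrite cardFn -(even_halfK n_even) -addnn -s_eq expnD -cardFr.
  by have := finNzRing_gt1 Fr; case: #|Fr| => [//|m] _ /=; rewrite mulnS.
rewrite [(_ + _)%:R]natrD addrK => /eqP; rewrite eqr_nat -[X in _ == X]muln1.
rewrite eqn_pmul2l; last exact: ltnW (finNzRing_gt1 Fr).
case/cards1P => y /setP single x Px.
have := single 0; have := single x; rewrite !inE Px P0 !eqxx => /esym/eqP -> /esym/eqP <- //.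
Qed.

(** [delta] counts the cell e_0: it is 1 exactly when P^(0) has a nontrivial zero. *)
Definition anisotropy (delta : nat) (P0 : Fn -> Fr) : Prop :=
  (delta = 1%N /\ exists2 x, x != 0 & P0 x = 0) \/ (delta = 0%N /\ forall x, P0 x = 0 -> x = 0).

(** The common interface of the two choices. Opposite signs at z = 0 and z <> 0 give non-weak
    regularity; Q 0 = P 0 / 4 and the surjectivity onto nonzero values make the dual label take the
    same values as the label. *)
Definition bent_family (Fq : finFieldType) (delta : nat) (P : Fq -> Fn -> Fr) : Prop :=
  exists (Q : Fq -> Fn -> Fr) (e : Fq -> Fr -> bool),
  [/\ forall z, Walsh_pair p n (P z) (Q z) (e z),
      forall z z', (z == 0) = (z' == 0) -> P z =1 P z',
      forall z z', (z == 0) = (z' == 0) -> Q z =1 Q z' &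
      forall z z', (z == 0) = (z' == 0) -> e z =1 e z'] /\
  [/\ forall z t, z != 0 -> t != 0 -> e z t = ~~ e 0 t,
      forall x, Q 0 x = 4^-1 * P 0 x,
      P 0 0 = 0,
      forall z x, P z (- x) = P z x &
      forall i, i != 0 -> exists2 x, x != 0 & P 0 x = i] /\
  anisotropy delta (P 0).

Lemma Walsh_pair_trace_square (e : Fr -> bool) :
    (forall t, t != 0 -> Gauss p (iota t) = (-1) ^+ e t * p%:R ^+ n./2) ->
  Walsh_pair p n (fun x => tr iota (x ^+ 2)) (fun u => 4^-1 * tr iota (u ^+ 2)) e.
Proof.
move=> e_Gauss; have := @Walsh_pair_square 1 e (oner_neq0 _) _; rewrite mulr1 => pair.
apply: (@Walsh_pair_ext (fun x => tr iota (iota 1 * x ^+ 2))).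
  by move=> x; rewrite rmorph1 mul1r.
by apply: pair => t t_nz; rewrite mul1r; apply: e_Gauss.
Qed.

Lemma choice_b_bent_family (Fq : finFieldType) (P : Fq -> Fn -> Fr) :
  choice_b n s iota P -> bent_family 1 P.
Proof.
case=> nu [[_ _ d_odd d_ge3] [nu_nsq P0E P1E]].
have nu_nz : nu != 0 by apply: contraTneq (nu_nsq 0) => ->; rewrite expr0n eqxx.
have cardE : #|Fn| = (#|Fr| ^ (n %/ s))%N by rewrite cardFr -expnM mulnC divnK // cardFn.
have inu_nz : iota nu != 0 by rewrite fmorph_eq0.
(* If y^2 = nu, then y^r = nu^((r-1)/2) y = - y. Applying this an odd number n / s of times gives
   y^|Fn| = - y, whereas y^|Fn| = y; so y = 0. *)
have inu_nsq (y : Fn) : y ^+ 2 != iota nu.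
  apply/eqP => y2.
  have nu_half : nu ^+ #|Fr|.-1./2 = -1 := nonsquare_half p_pr p_odd cardFr nu_nz nu_nsq.
  have Fr_gt0 : (0 < #|Fr|)%N by apply/card_gt0P; exists 0.
  have r_odd : odd #|Fr| by rewrite cardFr oddX p_odd orbT.
  have y_r : y ^+ #|Fr| = - y.
    rewrite -(prednK Fr_gt0) exprS -(half_card_pred p_odd cardFr) mulnC exprM y2 -rmorphXn nu_half.
    by rewrite rmorphN1 mulrN1.
  have y_iter j : y ^+ (#|Fr| ^ j) = (-1) ^+ j * y.
    elim: j => [|j IHj]; first by rewrite expn0 expr1 mul1r.
    rewrite expnSr exprM IHj exprMn y_r -exprM exprSr mulrN mulrN1 mulNr; congr (- (_ * _)).
    by rewrite -[LHS]signr_odd oddM r_odd andbT signr_odd.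
  have := expf_card y; rewrite cardE y_iter -signr_odd d_odd expr1 mulN1r => /eqP.
  rewrite eq_sym -addr_eq0 -mulr2n -mulr_natl mulf_eq0 (negPf (two_neq0 p_pr p_odd cardFn)) /=.
  by move/eqP => y0; move: y2 inu_nz; rewrite y0 expr0n => <-; rewrite eqxx.
pose C : algC := p%:R ^+ n./2.
(* The sign is read off from the Gauss sum without being computed: -1 is a square in Fn, so the
   Gauss sums at t and -t coincide, and by [GaussN] their common square is C^2. *)
pose e0 (t : Fr) := Gauss p (iota t) != C.
have [i i2] := square_minus1 p_pr p_odd cardFn n_even.
have i_nz : i != 0 by apply/eqP => i0; move/eqP: i2; rewrite i0 expr0n eq_sym oppr_eq0 oner_eq0.
have e0E t : t != 0 -> Gauss p (iota t) = (-1) ^+ e0 t * C.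
  move=> t_nz; have it_nz : iota t != 0 by rewrite fmorph_eq0.
  have := GaussN p_pr p_odd cardFn it_nz.
  have -> : - iota t = iota t * i ^+ 2 by rewrite i2 mulrN1.
  rewrite Gauss_square // -(sqr_half_power cardFn n_even) -!expr2 => /eqP; rewrite eqf_sqr /e0 -/C.
  by case: eqP => /= [-> _ | _ /eqP ->]; rewrite ?mul1r // expr1 mulN1r.
exists (fun z => if z == 0 then fun u => 4^-1 * tr iota (u ^+ 2)
                 else fun u => (4 * nu)^-1 * tr iota (u ^+ 2)).
exists (fun z => if z == 0 then e0 else fun t => ~~ e0 t).
have P0_pair : Walsh_pair p n (P 0) (fun u => 4^-1 * tr iota (u ^+ 2)) e0.
  by apply: Walsh_pair_ext (Walsh_pair_trace_square e0E) => x; rewrite P0E.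
have P00 : P 0 0 = 0 by rewrite P0E expr0n (tr_0 p_pr iota cardFr cardFn s_dvd_n).
have Q00 : 4^-1 * tr iota (0 ^+ 2) = 0.
  by rewrite expr0n (tr_0 p_pr iota cardFr cardFn s_dvd_n) mulr0.
have n_eq : n = (n %/ s * s)%N by rewrite divnK.
have s_lt : (s < n./2)%N.
  (* For s = 1 the even number n would equal the odd number n / s. With s >= 2 and n >= 3 s, half of
     n exceeds s. *)
  have s_gt1 : (1 < s)%N.
    have := finNzRing_gt1 Fr; rewrite cardFr; case: s n_eq d_odd n_even => [|[|]] //.
    by rewrite muln1 => <- ->.
  by move: n_eq d_ge3 s_gt1; set d := (n %/ s)%N; clear; nia.
split; [split=> [z | z z' zz' x | z z' -> | z z' ->] // | split; [split | left; split] => //].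
- case: eqP => [-> | /eqP z_nz] //.
  apply: (@Walsh_pair_ext (fun x => tr iota (iota nu * x ^+ 2))).
    by move=> x; rewrite P1E.
  apply: Walsh_pair_square => // t t_nz.
  rewrite rmorphM (Gauss_nonsquare p_pr p_odd cardFn) ?fmorph_eq0 // e0E // -mulNr.
  by case: (e0 t) => /=; rewrite ?opprK.
- by case: (eqVneq z 0) zz' => [-> /esym/eqP -> // | z_nz /esym/negbT z'_nz]; rewrite !P1E.
- by move=> z t /negPf -> _; rewrite eqxx.
- by move=> x; rewrite eqxx P0E.
- by move=> z x; have [-> | z_nz] := eqVneq z 0; rewrite ?P0E ?P1E // sqrrN.
- move=> j j_nz; apply: (Walsh_pair_surj P0_pair) => //; exact: ltnW.
- exact: (Walsh_pair_isotropic P0_pair).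
Qed.

Section QuadraticExtension.

Variables (m : nat) (Fm : finFieldType) (iota_mn : {rmorphism Fm -> Fn}).
Hypotheses (n_eq : n = (2 * m)%N) (cardFm : #|Fm| = (p ^ m)%N).

Let m_dvd_n : (m %| n)%N. Proof. by rewrite n_eq dvdn_mull. Qed.
Let cardE : #|Fn| = (#|Fm| ^ 2)%N. Proof. by rewrite cardFm -expnM cardFn n_eq mulnC. Qed.

(* With i = x ^ (M - 1), the equation x ^ 2 + x ^ (2 M) = 0 reads i ^ 2 = -1; then
   i ^ (M - 1) = 1 as 4 | M - 1, and i ^ (M + 1) = 1, so that i ^ 2 = 1. *)
Lemma trace_square_anisotropic (x : Fn) :
  (#|Fm| = 1 %[mod 4])%N -> tr iota_mn (x ^+ 2) = 0 -> x = 0.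
Proof.
move=> M_mod tr0; apply/eqP/negPn/negP => x_nz.
have := trP iota_mn (x ^+ 2) cardE; rewrite tr0 rmorph0 !big_ord_recl big_ord0 /=.
rewrite /bump /= expn0 expr1 addr0 addn0 expn1 => /esym/eqP.
set M := #|Fm| in M_mod *; have M_gt1 : (1 < M)%N := finNzRing_gt1 Fm.
pose i := x ^+ M.-1.
have xM : x ^+ M = i * x by rewrite /i -exprSr prednK // ltnW.
rewrite -exprM mulnC exprM xM exprMn -{1}[x ^+ 2]mul1r -mulrDl mulf_eq0 sqrf_eq0 (negPf x_nz) orbF.
rewrite addrC addr_eq0 => /eqP i2.
have i_pred : i ^+ M.-1 = 1.
  have -> : M.-1 = (2 * (2 * (M.-1 %/ 4)))%N by clear -M_mod M_gt1; lia.
  by rewrite exprM i2 exprM sqrrN expr1n expr1n.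
have i_succ : i ^+ M.+1 = 1.
  rewrite /i -exprM -(expf_card_pred x_nz) cardE -/M; congr (_ ^+ _).
  by case: (M) M_gt1 => // j _; rewrite -mulnn; clear; lia.
move: i_succ; rewrite -(prednK (ltnW M_gt1)) -addn2 exprD i_pred mul1r i2 => /eqP.
rewrite eq_sym -addr_eq0 -[1 + 1]/(2%:R); exact/negP/(two_neq0 p_pr p_odd cardFn).
Qed.

(** Every element of the subfield is a square in its quadratic extension: with M = |Fm|, the Euler
    exponent (M^2 - 1) / 2 is a multiple of M - 1. *)
Lemma Gauss_subfield (t : Fm) : t != 0 -> Gauss p (iota_mn t) = Gauss p (1 : Fn).
Proof.
move=> t_nz; have it_nz : iota_mn t != 0 by rewrite fmorph_eq0.
have [y yE] : exists y, y ^+ 2 = iota_mn t.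
  apply: (Euler_square p_pr p_odd cardFn it_nz).
  have M_odd : odd #|Fm| by rewrite cardFm oddX p_odd orbT.
  have -> : (#|Fn|.-1./2 = #|Fm|.-1 * #|Fm|.+1./2)%N.
    rewrite cardE -mulnn -[#|Fm|]odd_double_half M_odd; set j := #|Fm|./2.
    have -> : ((true + j.*2) * (true + j.*2)).-1 = (j.*2 * j.+1).*2 by clear; lia.
    rewrite doubleK; congr (_ * _)%N; clear; lia.
  by rewrite exprM -rmorphXn expf_card_pred // rmorph1 expr1n.
have y_nz : y != 0 by apply: contraNneq it_nz => y0; rewrite -yE y0 expr0n.
by rewrite -yE -[y ^+ 2]mul1r Gauss_square.
Qed.

(** The Gauss sums at all u in Fm are added up. By anisotropy of the trace of x^2 only x = 0
    contributes, so the total is M = |Fm|; on the other hand it is M^2 + (M - 1) G with G the common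
    value at u <> 0. Hence G = - M. *)
Lemma Gauss_quadratic_extension (t : Fm) : (#|Fm| = 1 %[mod 4])%N -> t != 0 ->
  Gauss p (iota_mn t) = - p%:R ^+ m.
Proof.
move=> M_mod t_nz; rewrite Gauss_subfield //.
have : \sum_(u : Fm) Gauss p (iota_mn u) = #|Fm|%:R.
  rewrite /Gauss exchange_big /=.
  transitivity (\sum_(x : Fn) if x == 0 then #|Fm|%:R else 0 : algC).
    apply: eq_bigr => x _.
    transitivity (\sum_(u : Fm) psi (tr1 p (tr iota_mn (x ^+ 2) * u))).
      apply: eq_bigr => u _; rewrite [_ * u]mulrC -(tr_scale iota_mn cardFm cardFn m_dvd_n).
      by rewrite (tr1_tr p_pr iota_mn cardFm cardFn m_dvd_n).
    rewrite (sum_psi_all p_pr cardFm); congr (if _ then _ else _).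
    apply/eqP/eqP => [/trace_square_anisotropic -> // | ->].
    by rewrite expr0n (tr_0 p_pr iota_mn cardFm cardFn m_dvd_n).
  by rewrite (bigD1 0 isT) /= eqxx big1 ?addr0 // => x /negPf ->.
rewrite (bigD1 0 isT) /= rmorph0.
have -> : Gauss p (0 : Fn) = #|Fm|%:R * #|Fm|%:R.
  rewrite -natrM mulnn -cardE -[#|Fn|]sum1_card natr_sum; apply: eq_bigr => x _.
  by rewrite mul0r (tr1_0 p_pr cardFn).
rewrite (eq_bigr (fun=> Gauss p (1 : Fn))); last by move=> u; apply: Gauss_subfield.
rewrite sumr_const cardC1 -natrX -cardFm => G_eq.
have M1_nz : #|Fm|.-1%:R != 0 :> algC.
  by rewrite pnatr_eq0; have := finNzRing_gt1 Fm; case: #|Fm| => [|[]].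
apply: (mulIf M1_nz); rewrite mulr_natr -[LHS](addKr (#|Fm|%:R * #|Fm|%:R)) G_eq.
have -> : #|Fm|%:R = #|Fm|.-1%:R + 1 :> algC.
  by rewrite natr1 prednK // ltnW // finNzRing_gt1.
ring.
Qed.

(** The summand is linear in the second coordinate x2, and the sum over x2 forces x1 = u2 / t. Here
    u1 and u2 are the coefficients of the linear form Tr (u x) in the coordinates (x1, x2); all
    signs are +1. *)
Lemma Walsh_pair_hyperbolic (iota_rm : {rmorphism Fr -> Fm}) (b1 b2 : Fn) (P : Fn -> Fr) :
    let of_coords (x : Fm * Fm) := iota_mn x.1 * b1 + iota_mn x.2 * b2 in
    (s %| m)%N -> bijective of_coords ->
    (forall x, P (of_coords x) = tr iota_rm (x.1 * x.2)) ->
  Walsh_pair p n P (fun u => tr iota_rm (tr iota_mn (u * b1) * tr iota_mn (u * b2))) xpred0.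
Proof.
move=> of_coords s_dvd_m of_coords_bij PE t t_nz u.
set u1 := tr iota_mn (u * b1); set u2 := tr iota_mn (u * b2).
have it_nz : iota_rm t != 0 by rewrite fmorph_eq0.
rewrite (reindex of_coords) /=; last exact: onW_bij.
transitivity (\sum_(x1 : Fm) psi (- tr1 p (u1 * x1)) *
                \sum_(x2 : Fm) psi (tr1 p ((iota_rm t * x1 - u2) * x2))).
  under [RHS]eq_bigr do rewrite mulr_sumr; rewrite pair_bigA /=.
  apply: eq_bigr => -[x1 x2] _ /=; rewrite -psiD // PE /=; congr psi.
  rewrite -(tr_scale iota_rm cardFr cardFm s_dvd_m) (tr1_tr p_pr iota_rm cardFr cardFm s_dvd_m).
  rewrite /of_coords /= mulrDr (tr1D p_pr cardFn) mulrBl (tr1_additive p_pr cardFm).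
  have trE (c : Fm) (b : Fn) : tr1 p (u * (iota_mn c * b)) = tr1 p (tr iota_mn (u * b) * c).
    rewrite mulrC [_ * c in RHS]mulrC -(tr_scale iota_mn cardFm cardFn m_dvd_n).
    rewrite (tr1_tr p_pr iota_mn cardFm cardFn m_dvd_n); congr (tr1 _ _); ring.
  rewrite !trE mulrA; ring.
rewrite (bigD1 (u2 / iota_rm t) isT) [X in _ + X = _]big1 /=; last first.
  move=> x1 x1_neq; rewrite (sum_psi_all p_pr cardFm) ifN ?mulr0 // subr_eq0.
  by apply: contraNneq x1_neq => <-; rewrite mulrC mulKf.
rewrite (sum_psi_all p_pr cardFm) [iota_rm t * _]mulrC divfK // subrr eqxx addr0 mulrC.
rewrite mul1r cardFm natrX n_eq mul2n doubleK; congr (_ * psi (- _)).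
rewrite [_ / t]mulrC -(tr_scale iota_rm cardFr cardFm s_dvd_m).
rewrite (tr1_tr p_pr iota_rm cardFr cardFm s_dvd_m) fmorphV; congr (tr1 _ _); ring.
Qed.

End QuadraticExtension.

Lemma choice_a_bent_family (Fq : finFieldType) (P : Fq -> Fn -> Fr) :
  choice_a p n s iota P -> bent_family (if n == (2 * s)%N then 0%N else 1%N) P.
Proof.
case=> m [Fm [iota_rm [iota_mn [b1 [b2 [[n_eq s_dvd_m cardFm] [p_mod]]]]]]].
case=> iotaE bij_coords P0E P1E.
set of_coords := (fun x : Fm * Fm => _) in bij_coords P1E.
(* If p is 3 modulo 4, then 4 divides n, so m is even and |Fm| is a power of p^2. *)
have M_mod : (#|Fm| = 1 %[mod 4])%N.
  rewrite cardFm; case: p_mod => [p1 | [p3 n0]]; first by rewrite -modnXm p1 modnXm exp1n.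
  have -> : m = (2 * (m %/ 2))%N by lia.
  rewrite expnM -modnXm; have -> : (p ^ 2 = 1 %[mod 4])%N by rewrite -modnXm p3.
  by rewrite modnXm exp1n.
pose e0 (t : Fr) := true.
have e0E t : t != 0 -> Gauss p (iota t) = (-1) ^+ e0 t * p%:R ^+ n./2.
  move=> t_nz; rewrite -iotaE /= (Gauss_quadratic_extension iota_mn n_eq cardFm) ?fmorph_eq0 //.
  by rewrite expr1 mulN1r n_eq mul2n doubleK.
have P0_pair : Walsh_pair p n (P 0) (fun u => 4^-1 * tr iota (u ^+ 2)) e0.
  by apply: Walsh_pair_ext (Walsh_pair_trace_square e0E) => x; rewrite P0E.
have P00 : P 0 0 = 0 by rewrite P0E expr0n (tr_0 p_pr iota cardFr cardFn s_dvd_n).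
have Q00 : 4^-1 * tr iota (0 ^+ 2) = 0.
  by rewrite expr0n (tr_0 p_pr iota cardFr cardFn s_dvd_n) mulr0.
have n_half : n./2 = m by rewrite n_eq mul2n doubleK.
have m_gt0 : (0 < m)%N by have := finNzRing_gt1 Fm; rewrite cardFm; case: (m).
have s_le : (s <= m)%N := dvdn_leq m_gt0 s_dvd_m.
exists (fun z => if z == 0 then fun u => 4^-1 * tr iota (u ^+ 2)
                 else fun u => tr iota_rm (tr iota_mn (u * b1) * tr iota_mn (u * b2))).
exists (fun z => if z == 0 then e0 else fun=> false).
split; [split=> [z | z z' zz' x | z z' -> | z z' ->] // | split; [split | ] => //].
- case: eqP => [-> | /eqP z_nz] //.
  exact: (Walsh_pair_hyperbolic n_eq cardFm s_dvd_m bij_coords (P1E z z_nz)).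
- case: (eqVneq z 0) zz' => [-> /esym/eqP -> // | z_nz /esym/negbT z'_nz].
  by have [g _ gK] := bij_coords; rewrite -[x]gK !P1E.
- by move=> z t /negPf -> _; rewrite eqxx.
- by move=> x; rewrite eqxx P0E.
- move=> z x; have [-> | z_nz] := eqVneq z 0; first by rewrite !P0E sqrrN.
  have [g _ gK] := bij_coords; rewrite -[x]gK.
  have -> : - of_coords (g x) = of_coords (- g x) by rewrite /of_coords /= !rmorphN; ring.
  by rewrite !P1E //= mulrNN.
- by move=> j j_nz; apply: (Walsh_pair_surj P0_pair); rewrite ?n_half.
(* n = 2 s means r = p^(n/2), and as all signs at z = 0 are -1 the form is anisotropic. Otherwise s
   < m because s divides m. *)
- case: eqP => [n2s | n2s]; [right | left]; split=> //.
    by apply: (Walsh_pair_anisotropic P0_pair) => //; rewrite n_half; clear -n2s n_eq; lia.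
  by apply: (Walsh_pair_isotropic P0_pair); rewrite // n_half; clear -n2s n_eq s_le; lia.
Qed.

End Choices.

(** * Bentness and duals *)

Section WalshPolar.

Variables (p : nat) (W : finZmodType) (form : W -> W -> 'F_p).
Hypotheses (p_pr : prime p) (p_odd : odd p).
Variables (f : W -> 'F_p) (e : W -> bool) (g : W -> 'F_p).
Hypothesis f_Walsh : forall b, Walsh form f b = (-1) ^+ e b * half_order p W * psi (g b).

(** The p-th power removes psi and, p being odd, keeps the sign. *)
Lemma signed_psi_inj (a b : bool) (c d : 'F_p) :
  (-1) ^+ a * psi c = (-1) ^+ b * psi d -> (a, c) = (b, d).
Proof.
move=> eq_ac; have psi_p (x : 'F_p) : psi x ^+ p = 1.
  by rewrite /psi -exprM mulnC exprM (prim_expr_order (zeta_primitive p_pr)) expr1n.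
have sign_p (x : bool) : ((-1) ^+ x) ^+ p = (-1) ^+ x :> algC.
  by case: x; rewrite ?expr1n // expr1 -signr_odd p_odd.
have /eqP := congr1 (fun x => x ^+ p) eq_ac.
rewrite !exprMn !psi_p !sign_p !mulr1 (inj_eq (@signr_inj _)) => /eqP ab.
by move: eq_ac; rewrite ab => /(mulfI _)/(psi_inj p_pr) -> //; rewrite signr_eq0.
Qed.

(** By [signed_psi_inj] the pair is unique, so the pick finds it and the default is never
    reached. *)
Lemma Walsh_polarE b : Walsh_polar form f b = (e b, g b).
Proof.
have C_nz : half_order p W != 0 := p_natr_neq0 p_pr _.
have polar (ec : bool * 'F_p) :
    (Walsh form f b == (-1) ^+ ec.1 * half_order p W * zeta p ^+ nat_of_ord ec.2) =
    (ec == (e b, g b)).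
  apply/eqP/eqP => [|->]; last exact: f_Walsh.
  rewrite f_Walsh -[zeta p ^+ _]/(psi ec.2) -!mulrA ![_ * (half_order p W * _)]mulrCA.
  by move=> /(mulfI C_nz)/signed_psi_inj ->; case: ec.
rewrite /Walsh_polar; case: pickP => [ec | /(_ (e b, g b))]; first by rewrite polar => /eqP.
by rewrite polar eqxx.
Qed.

Lemma Walsh_bent : bent form f.
Proof.
move=> b; rewrite f_Walsh !normrM normr_sign mul1r norm_psi // mulr1.
by rewrite /half_order normrX normr_nat.
Qed.

Lemma Walsh_dual : dual form f =1 g.
Proof. by move=> b; rewrite /dual Walsh_polarE. Qed.

Lemma Walsh_non_weakly_regular b b' : e b != e b' -> non_weakly_regular form f.
Proof.
move=> e_neq; split=> [|[_ [c sign_c]]]; first exact: Walsh_bent.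
have /eqP := etrans (sign_c b) (esym (sign_c b')).
by rewrite /Walsh_sign !Walsh_polarE (inj_eq (@signr_inj _)) (negPf e_neq).
Qed.

End WalshPolar.

(** * Bentness, non-weak regularity and the vectorial dual of H *)

Section VectorialBent.

Variables (p n k s : nat) (Fr Fq Fn : finFieldType) (iota : {rmorphism Fr -> Fq}).
Hypotheses (p_pr : prime p) (p_odd : odd p) (s_dvd_k : (s %| k)%N).
Hypotheses (cardFr : #|Fr| = (p ^ s)%N) (cardFq : #|Fq| = (p ^ k)%N) (cardFn : #|Fn| = (p ^ n)%N).
Hypothesis n_even : ~~ odd n.

Local Notation V := (Fn * Fq * Fq)%type.
Local Notation form := (@V_form Fn Fq p).

Lemma half_order_V : half_order p V = #|Fq|%:R * p%:R ^+ n./2.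
Proof.
rewrite /half_order !card_prod cardFq cardFn -!expnD pfactorK // -addnA addnn.
by rewrite halfD (negPf n_even) doubleK /= add0n exprD natrX mulrC.
Qed.

Lemma Walsh_component (P Q : Fq -> Fn -> Fr) (e : Fq -> Fr -> bool) (t : Fr) (b : V) :
    (forall z, Walsh_pair p n (P z) (Q z) (e z)) ->
    (forall z z', (z == 0) = (z' == 0) -> Q z =1 Q z') ->
    (forall z z', (z == 0) = (z' == 0) -> e z =1 e z') ->
    t != 0 ->
  Walsh form (component p (H_of iota P) t) b =
    (-1) ^+ e b.1.2 t * half_order p V * psi (- tr1 p (H_dual iota Q b / t)).
Proof.
move=> PQ Q_dep e_dep t_nz.
transitivity (\sum_(v : V | v.2 \in predT) psi (tr1 p (t * H_of iota P v) - form b v)).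
  exact: eq_bigl.
rewrite (sum_psi_H p_pr s_dvd_k cardFr cardFq PQ Q_dep e_dep b t_nz) // inE /=.
by rewrite half_order_V; congr (_ * _); rewrite mulrCA.
Qed.

Variables (delta : nat) (P : Fq -> Fn -> Fr).
Hypothesis P_family : bent_family p n delta P.

Lemma H_non_weakly_regular t : t != 0 -> non_weakly_regular form (component p (H_of iota P) t).
Proof.
move=> t_nz; have [Q [e [[PQ _ Q_dep e_dep] [[e_neg _ _ _ _] _]]]] := P_family.
have W b := Walsh_component b PQ Q_dep e_dep t_nz.
(* The sign at xi depends on whether its second coordinate is 0; the two points differ in this. *)
apply: (Walsh_non_weakly_regular p_pr p_odd W (b := (0, 0, 0)) (b' := (0, 1, 0))) => /=.
by rewrite (e_neg 1) ?oner_neq0 //; case: (e 0 t).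
Qed.

Lemma H_vectorial_dual_bent : vectorial_dual_bent form (H_of iota P).
Proof.
have [Q [e [[PQ P_dep Q_dep e_dep] [[e_neg _ _ P_even _] _]]]] := P_family.
split=> [t t_nz | ].
  apply: (Walsh_bent p_pr (g := fun b => - tr1 p (H_dual iota Q b / t))) => b.
  exact: Walsh_component.
(* The dual of the component t is - Tr ([H_dual] / t), which dictates both witnesses; inversion
   fixes 0 since 0^-1 = 0 here. *)
exists (fun xi => - H_dual iota Q xi), (perm (@invr_inj Fr)).
split=> [t t_nz | | t t_nz xi]; last 2 first.
- by rewrite permE invr0.
- rewrite (Walsh_dual p_pr p_odd (fun b => Walsh_component b PQ Q_dep e_dep t_nz)).
  by rewrite permE /component mulrN (tr1N p_pr cardFr) mulrC.
(* Up to the exchange of y and z, [H_dual] is the function H built from Q, and [Walsh_pair_sym]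
   makes (Q, P) a Walsh pair. The minus sign of the witness is absorbed by using the component -
   t. *)
pose swap (v : V) : V := (v.1.1, v.2, v.1.2).
have swapK : involutive swap by move=> [[x y] z].
have Nt_nz : - t != 0 by rewrite oppr_eq0.
have QP z : Walsh_pair p n (Q z) (P z) (fun u => e z (- u^-1)).
  exact: (Walsh_pair_sym p_pr cardFr cardFn n_even (P_even z) (PQ z)).
have e_dep' z z' : (z == 0) = (z' == 0) -> (fun u => e z (- u^-1)) =1 (fun u => e z' (- u^-1)).
  by move=> zz' u; apply: e_dep.
have W b := Walsh_component b QP P_dep e_dep' Nt_nz.
have := Walsh_bent p_pr W => Q_bent b; rewrite -(Q_bent (swap b)); congr `|_|.
rewrite /Walsh (reindex_inj (inv_inj swapK)); apply: eq_bigr => -[[x y] z] _.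
congr (_ ^+ nat_of_ord _); rewrite /component /H_dual /H_of /V_form /= mulrN mulNr [y * z]mulrC.
by congr (_ - _); ring.
Qed.

End VectorialBent.

(** * Lines and subspaces *)

Lemma mem_preim_partition_level (T L : finType) (Phi : T -> L) (S : {set T}) :
  reflect (S != set0 /\ exists l, S = level Phi l) (S \in preim_partition Phi [set: T]).
Proof.
apply: (iffP (mem_preim_partition Phi S)) => [[x ->] | [/set0Pn[x] + [l S_l]]].
  by split; [apply/set0Pn; exists x; rewrite inE | exists (Phi x)].
by rewrite S_l inE => /eqP <-; exists x.
Qed.

Lemma tr_id (F : finFieldType) (x : F) : tr idfun x = x.
Proof.
have := @trP F F idfun 1 x; rewrite expn1 => /(_ erefl) /= ->.
by rewrite big_ord_recl big_ord0 /= expn0 expr1 addr0.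
Qed.

Section Scaling.

Variables (p k s : nat) (Fr Fq : finFieldType) (iota : {rmorphism Fr -> Fq}).
Hypotheses (p_pr : prime p) (s_dvd_k : (s %| k)%N).
Hypotheses (cardFr : #|Fr| = (p ^ s)%N) (cardFq : #|Fq| = (p ^ k)%N).

(** z = 0 is allowed: the degenerate line {0} is the label that separates 0 from all other
    points. *)
Definition line (z : Fq) : {set Fq} := [set iota a * z | a : Fr].

Lemma mem_line z : z \in line z.
Proof. by apply/imsetP; exists 1; rewrite // rmorph1 mul1r. Qed.

Lemma line_scale a z : a != 0 -> line (iota a * z) = line z.
Proof.
move=> a_nz; apply/setP => y; apply/imsetP/imsetP => -[b _ ->].
  by exists (b * a); rewrite // rmorphM mulrA.
by exists (b / a); rewrite // mulrA -rmorphM divfK.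
Qed.

Lemma line_eq z z' : line z = line z' -> exists2 a, a != 0 & z' = iota a * z.
Proof.
move=> zz'; have := mem_line z'; rewrite -zz' => /imsetP[a _ z'E].
have [a0 | a_nz] := eqVneq a 0; last by exists a.
have z'0 : z' = 0 by rewrite z'E a0 rmorph0 mul0r.
have := mem_line z; rewrite zz' => /imsetP[b _ zE].
by exists 1; rewrite ?oner_neq0 // rmorph1 mul1r zE z'0 mulr0.
Qed.

Lemma line0 y : line y = line 0 -> y = 0.
Proof. by case/esym/line_eq => a _ ->; rewrite mulr0. Qed.

Lemma lineN z : line (- z) = line z.
Proof. by rewrite -mulN1r -(rmorphN1 iota) line_scale // oppr_eq0 oner_eq0. Qed.

Lemma linesE : lines iota = line @: [set~ 0].
Proof.
by apply/setP => L; apply/imsetP/imsetP => -[z z_nz ->]; exists z; rewrite // !inE in z_nz *.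
Qed.

(** Here w' is a scalar multiple of w, and the scalar can be moved to z because A is scale
    invariant. *)
Lemma sum_line_eq (A : pred Fq) w w' : (forall a z, a != 0 -> A (iota a * z) = A z) ->
  line w = line w' ->
  \sum_(z | A z) psi (- tr1 p (w * z)) = \sum_(z | A z) psi (- tr1 p (w' * z)).
Proof.
move=> A_scale /line_eq[a a_nz ->]; have ia_nz : iota a != 0 by rewrite fmorph_eq0.
rewrite (reindex_inj (mulfI ia_nz)) /=; apply: eq_big => [z | z _]; first exact: A_scale.
by rewrite mulrCA mulrA.
Qed.

Lemma card_line z : z != 0 -> #|line z :\ 0| = #|Fr|.-1.
Proof.
move=> z_nz; have := cardsD1 0 (line z).
have -> : 0 \in line z by apply/imsetP; exists 0; rewrite // rmorph0 mul0r.
rewrite card_imset => [-> // | a b /(mulIf z_nz)]; exact: fmorph_inj.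
Qed.

(** The lines without 0 partition the nonzero elements of F_q into sets of size r - 1. *)
Lemma card_lines : #|lines iota| = ((#|Fq| - 1) %/ (#|Fr| - 1))%N.
Proof.
have r_gt1 := finNzRing_gt1 Fr.
pose D := [set~ (0 : Fq)]; pose Pt := preim_partition line D.
have mem_D z : (z \in D) = (z != 0) by rewrite !inE.
have class z : z \in D -> [set y in D | line z == line y] = line z :\ 0.
  rewrite mem_D => z_nz; apply/setP => y; rewrite in_setD1 inE mem_D; case: eqP => //= y_nz.
  apply/eqP/imsetP => [/line_eq[a _ ->] | [a _ yE]]; first by exists a.
  rewrite yE line_scale //; apply: contra_not_neq y_nz => a0; by rewrite yE a0 rmorph0 mul0r.
have PtE : Pt = [set line z :\ 0 | z in D].
  by apply/setP => S; apply/imsetP/imsetP => -[z zD ->]; exists z; rewrite // class.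
have cardPt : #|Pt| = #|lines iota|.
  rewrite PtE linesE (imset_comp (fun L : {set Fq} => L :\ 0) line) card_in_imset //.
  move=> _ _ /imsetP[y yD ->] /imsetP[z zD ->] /setP/(_ y).
  rewrite !in_setD1 mem_line; move: yD; rewrite mem_D => y_nz; rewrite y_nz /=.
  case/esym/imsetP => a _ yE; rewrite yE line_scale //.
  by apply: contraNneq y_nz => a0; rewrite yE a0 rmorph0 mul0r.
have : {in Pt, forall S : {set Fq}, #|S| = #|Fr|.-1}.
  by move=> S; rewrite PtE => /imsetP[z]; rewrite mem_D => z_nz ->; apply: card_line.
move/(card_uniform_partition)/(_ (preim_partitionP line D)); rewrite cardsC1 cardPt => cardD.
by rewrite !subn1 cardD mulnK // -ltnS prednK // ltnW.
Qed.

(** * An F_r-subspace and its orthogonal for the trace form *)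

Section Subspace.

Variable K : {set Fq}.
Hypothesis K_subspace : subspace iota K.

Lemma subspaceD x y : x \in K -> (x + y \in K) = (y \in K).
Proof.
have [K0 K_lin] := K_subspace; move=> xK; apply/idP/idP => [xyK | yK].
  by have := K_lin (-1) x _ xK xyK; rewrite rmorphN1 mulN1r addKr.
by have := K_lin 1 x y xK yK; rewrite rmorph1 mul1r.
Qed.

Lemma subspaceZ a x : a != 0 -> (iota a * x \in K) = (x \in K).
Proof.
have [K0 K_lin] := K_subspace; have K_scale b y : y \in K -> iota b * y \in K.
  by move=> yK; have := K_lin b y 0 yK K0; rewrite addr0.
move=> a_nz; apply/idP/idP => [axK | xK]; last exact: K_scale.
by have := K_scale a^-1 _ axK; rewrite mulrA -rmorphM mulVf // rmorph1 mul1r.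
Qed.

Local Notation perp := (trace_perp p K).

Lemma mem_perp y : (y \in perp) = [forall z in K, tr1 p (y * z) == 0].
Proof. by rewrite inE; apply: eq_forallb => z; rewrite mulrC. Qed.

Lemma perp_subspace : subspace iota perp.
Proof.
split=> [|a x y].
  by rewrite mem_perp; apply/forall_inP => z _; rewrite mul0r (tr1_0 p_pr cardFq).
rewrite !mem_perp => /forall_inP xK /forall_inP yK; apply/forall_inP => z zK.
rewrite mulrDl (tr1D p_pr cardFq) (eqP (yK _ zK)) addr0.
have [a0 | a_nz] := eqVneq a 0.
  by rewrite a0 rmorph0 !mul0r (tr1_0 p_pr cardFq).
by rewrite [_ * x]mulrC -mulrA; apply: xK; rewrite subspaceZ.
Qed.

Lemma sum_subspace w : \sum_(z in K) psi (- tr1 p (w * z)) = if w \in perp then #|K|%:R else 0.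
Proof.
transitivity (\sum_(z in K) psi (tr1 p (- w * z))).
  by apply: eq_bigr => z _; rewrite mulNr (tr1N p_pr cardFq).
rewrite (sum_psi_tr1 p_pr cardFq) => [|x y]; last exact: subspaceD.
rewrite mem_perp; congr (if _ then _ else _); apply: eq_forallb => z.
by rewrite mulNr (tr1N p_pr cardFq) oppr_eq0.
Qed.

(* Fourier inversion for the indicator function of K. *)
Lemma sum_perp v :
  #|K|%:R * \sum_(y in perp) psi (- tr1 p (v * y)) = if v \in K then #|Fq|%:R else 0.
Proof.
transitivity (\sum_y \sum_(z in K) psi (- tr1 p (y * z)) * psi (- tr1 p (v * y))).
  rewrite mulr_sumr [LHS]big_mkcond /=; apply: eq_bigr => y _.
  by rewrite -mulr_suml sum_subspace; case: ifP; rewrite ?mul0r.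
rewrite exchange_big /=.
transitivity (\sum_(z in K) if z == - v then #|Fq|%:R else 0 : algC).
  apply: eq_bigr => z _.
  rewrite -[z == _]subr_eq0 opprK -oppr_eq0 -(sum_psi_all p_pr cardFq).
  apply: eq_bigr => y _; rewrite -psiD //; congr psi.
  by rewrite mulNr (tr1N p_pr cardFq) mulrDl (tr1D p_pr cardFq) [z * y]mulrC opprD.
rewrite big_mkcond (bigD1 (- v) isT) [X in _ + X = _]big1 /=; last first.
  by move=> z /negPf ->; rewrite if_same.
by rewrite eqxx addr0 -mulN1r -(rmorphN1 iota) subspaceZ // oppr_eq0 oner_eq0.
Qed.

Lemma card_perp : (#|K| * #|perp|)%N = #|Fq|.
Proof.
have := sum_perp 0; have [-> _] := K_subspace.
under eq_bigr do rewrite mul0r (tr1_0 p_pr cardFq) oppr0 psi0.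
by rewrite sumr_const -natrM => /eqP; rewrite eqr_nat => /eqP.
Qed.

(** The entry z == 0 is needed beside membership: a character sum over the complement of a subspace
    involves the sum over all of F_q, which distinguishes the trivial character. *)
Definition kappa_K (z : Fq) : bool * bool := (z == 0, z \in K).
Definition lambda_K (y : Fq) : bool * bool := (y == 0, y \in perp).

End Subspace.

(** The cells are {0}, K without 0, and the complement of K; their sums are 1, the sum over K minus
    1, and the full sum minus that over K. The label (true, false) has no points because 0 lies in
    K. *)
Lemma subspace_sums (K A : {set Fq}) :
    0 \in K -> (forall w w', (w == 0, w \in A) = (w' == 0, w' \in A) ->
       \sum_(z in K) psi (- tr1 p (w * z)) = \sum_(z in K) psi (- tr1 p (w' * z))) ->
  forall l w w', (w == 0, w \in A) = (w' == 0, w' \in A) ->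
  \sum_(z | (z == 0, z \in K) == l) psi (- tr1 p (w * z)) =
  \sum_(z | (z == 0, z \in K) == l) psi (- tr1 p (w' * z)).
Proof.
move=> K0 K_sums [a b] w w' ww'.
have sum0 (u : Fq) : \sum_(z | z == 0) psi (- tr1 p (u * z)) = 1.
  by rewrite big_pred1_eq mulr0 (tr1_0 p_pr cardFq) oppr0 psi0.
have sumK (u : Fq) : \sum_(z in K) psi (- tr1 p (u * z)) =
    1 + \sum_(z | (z == 0, z \in K) == (false, true)) psi (- tr1 p (u * z)).
  rewrite (bigD1 0) //= mulr0 (tr1_0 p_pr cardFq) oppr0 psi0; congr (_ + _).
  by apply: eq_bigl => z; rewrite xpair_eqE eqbF_neg eqb_id andbC.
have sumT (u : Fq) : \sum_z psi (- tr1 p (u * z)) = \sum_(z in K) psi (- tr1 p (u * z)) +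
    \sum_(z | (z == 0, z \in K) == (false, false)) psi (- tr1 p (u * z)).
  rewrite (bigID (mem K)) /=; congr (_ + _); apply: eq_bigl => z.
  rewrite xpair_eqE !eqbF_neg andbC; case: (eqVneq z 0) => [-> | _]; by rewrite ?K0 ?andbT.
have sumTE : \sum_z psi (- tr1 p (w * z)) = \sum_z psi (- tr1 p (w' * z)).
  have allE (u : Fq) : \sum_z psi (- tr1 p (u * z)) = if u == 0 then #|Fq|%:R else 0.
    rewrite -oppr_eq0 -(sum_psi_all p_pr cardFq); apply: eq_bigr => z _.
    by rewrite mulNr (tr1N p_pr cardFq).
  by rewrite !allE; case: ww' => ->.
have := K_sums w w' ww'; rewrite !sumK => /addrI sumK1.
case: a b => [] [] //.
- have labE z : ((z == 0, z \in K) == (true, true)) = (z == 0).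
    by rewrite xpair_eqE !eqb_id; case: eqP => // ->; rewrite K0.
  by rewrite !(eq_bigl _ _ labE) !sum0.
- by rewrite !big_pred0 // => z; rewrite xpair_eqE eqb_id eqbF_neg; case: eqP => // ->; rewrite K0.
- by have := sumTE; rewrite !sumT (K_sums w w' ww') => /addrI.
Qed.

End Scaling.

(** * The partitions of the theorem *)

(** What a pair of labellings of F_q must satisfy for [label] to give a scheme. The condition z != 0
    appears only for [kappa], because [label] applies [kappa] to nonzero z but [lambda] to every
    y. *)
Record dual_labels (p : nat) (Fr Fq : finFieldType) (iota : Fr -> Fq) (L1 L2 : finType)
    (kappa : Fq -> L1) (lambda : Fq -> L2) : Prop := DualLabels {
  dual_kappa_scale : forall a z, a != 0 -> kappa (iota a * z) = kappa z;
  dual_kappa_sums : forall l w w', lambda w = lambda w' ->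
    \sum_(z | (z != 0) && (kappa z == l)) psi (- tr1 p (w * z)) =
    \sum_(z | (z != 0) && (kappa z == l)) psi (- tr1 p (w' * z));
  dual_lambda_sums : forall l v v', kappa v = kappa v' ->
    \sum_(y | lambda y == l) psi (- tr1 p (v * y)) =
    \sum_(y | lambda y == l) psi (- tr1 p (v' * y));
  dual_lambdaN : forall z, lambda (- z) = lambda z;
  dual_lambda0 : forall y, lambda y = lambda 0 -> y = 0
}.

Section Final.

Variables (p n k s delta : nat) (Fr Fq Fn : finFieldType) (iota : {rmorphism Fr -> Fq}).
Variable P : Fq -> Fn -> Fr.
Hypotheses (p_pr : prime p) (p_odd : odd p) (s_dvd_k : (s %| k)%N).
Hypotheses (cardFr : #|Fr| = (p ^ s)%N) (cardFq : #|Fq| = (p ^ k)%N) (cardFn : #|Fn| = (p ^ n)%N).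

Local Notation V := (Fn * Fq * Fq)%type.
Local Notation form := (@V_form Fn Fq p).

Lemma line_dual_labels : dual_labels p iota (line iota) (line iota).
Proof.
split.
- exact: line_scale.
- move=> l w w'; apply: sum_line_eq => a z a_nz.
  by rewrite mulf_eq0 fmorph_eq0 (negPf a_nz) line_scale.
- move=> l w w'; apply: sum_line_eq => a z a_nz; by rewrite line_scale.
- exact: lineN.
- exact: line0.
Qed.

Section OneSubspace.

Variable K : {set Fq}.
Hypothesis K_sub : subspace iota K.
Let perp_sub := perp_subspace p_pr cardFq K_sub.

Lemma subspace_dual_labels : dual_labels p iota (kappa_K K) (lambda_K p K).
Proof.
have K0 : 0 \in K by have [] := K_sub.
have perp0 : 0 \in trace_perp p K by have [] := perp_sub.
(* The label already tells whether z = 0, so the extra condition either changes nothing or empties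
   the cell. *)
have kappaE (l : bool * bool) (f : Fq -> algC) :
    \sum_(z | (z != 0) && (kappa_K K z == l)) f z =
    if l.1 then 0 else \sum_(z | kappa_K K z == l) f z.
  case: l => [[] b] /=.
    by rewrite big_pred0 // => z; rewrite xpair_eqE; case: eqP.
  by apply: eq_bigl => z; rewrite xpair_eqE; case: eqP.
split.
- move=> a z a_nz; rewrite /kappa_K mulf_eq0 fmorph_eq0 (negPf a_nz).
  by rewrite (subspaceZ K_sub).
- move=> l w w' ww'; rewrite !kappaE; case: ifP => // _.
  apply: (subspace_sums p_pr cardFq K0 _ l ww') => u u' [_ uu'].
  by rewrite !(sum_subspace p_pr cardFq K_sub) uu'.
- move=> l v v'; apply: (subspace_sums p_pr cardFq perp0) => u u' [_ uu'].
  have K_nz : #|K|%:R != 0 :> algC by rewrite pnatr_eq0 -lt0n; apply/card_gt0P; exists 0.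
  by apply: (mulfI K_nz); rewrite !(sum_perp p_pr cardFq K_sub) uu'.
- move=> z; rewrite /lambda_K oppr_eq0 -mulN1r -(rmorphN1 iota).
  by rewrite (subspaceZ perp_sub) // oppr_eq0 oner_eq0.
- by move=> y [+ _]; rewrite eqxx => /eqP.
Qed.

Lemma perp_eq0 : (trace_perp p K == [set 0]) = (K == [set: Fq]).
Proof.
have K_gt0 : (0 < #|K|)%N by apply/card_gt0P; exists 0; have [] := K_sub.
have perp0 : 0 \in trace_perp p K by have [] := perp_sub.
have := card_perp p_pr cardFq K_sub => card_eq.
rewrite [RHS]eqEcard subsetT cardsT -card_eq /= -[X in (_ <= X)%N]muln1 leq_pmul2l //.
by rewrite eq_sym eqEcard sub1set perp0 cards1.
Qed.

Lemma perp_eqT : (trace_perp p K == [set: Fq]) = (K == [set 0]).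
Proof.
have perp_gt0 : (0 < #|trace_perp p K|)%N by apply/card_gt0P; exists 0; have [] := perp_sub.
have K0 : 0 \in K by have [] := K_sub.
have := card_perp p_pr cardFq K_sub => card_eq.
rewrite eqEcard subsetT cardsT -card_eq /= -[X in (_ <= X)%N]mul1n leq_pmul2r //.
by rewrite [RHS]eq_sym eqEcard sub1set K0 cards1.
Qed.

Lemma card_subspace_labels (A : {set Fq}) : 0 \in A ->
  #|(fun z => (z == 0, z \in A)) @: [set~ 0]| = ((A != [set 0%R]) + (A != [set: Fq]))%N.
Proof.
move=> A0.
have -> : (fun z => (z == 0, z \in A)) @: [set~ 0] =
    [set l | ~~ l.1 && (if l.2 then A != [set 0] else A != [set: Fq])].
  apply/setP => -[a b]; rewrite inE /=; apply/imsetP/idP.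
    case=> z; rewrite !inE => z_nz [-> ->]; rewrite z_nz /=.
    case: ifP => zA; [apply: contraNneq z_nz => A_eq | apply: contraFneq zA => ->].
      by rewrite A_eq inE in zA.
    by rewrite inE.
  case: a => //=; case: b => /=.
    move=> A_neq; have [z] : exists z, z \in A :\ 0.
      apply/set0Pn; apply: contraNneq A_neq => A_eq.
      by rewrite -(setD1K A0) A_eq setU0.
    by rewrite !inE => /andP[z_nz zA]; exists z; rewrite ?inE // (negPf z_nz) zA.
  rewrite -subTset => /subsetPn[z _ zA]; exists z; rewrite ?inE.
    by apply: contraNneq zA => ->.
  by rewrite (negPf zA); case: eqP zA => // ->; rewrite A0.
have -> : [set l : bool * bool | ~~ l.1 && (if l.2 then A != [set 0] else A != [set: Fq])] =
    setX [set false] [set b : bool | if b then A != [set 0] else A != [set: Fq]].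
  by apply/setP => -[a b]; rewrite !inE eqbF_neg.
rewrite cardsX cards1 mul1n -sum1_card big_mkcond big_bool !inE /=.
by do 2!case: (_ != _).
Qed.

(** The 1 is the label of 0. The orthogonal is {0} or F_q exactly when K is F_q or {0}, so the two
    remaining terms are those of K in exchanged order. *)
Lemma card_lambda_labels :
  #|lambda_K p K @: [set: Fq]| = (1 + ((K != [set 0%R]) + (K != [set: Fq])))%N.
Proof.
have perp0 : 0 \in trace_perp p K by have [] := perp_sub.
rewrite -[X in lambda_K p K @: pred_of_set X](setUCr [set 0]) imsetU1 cardsU1.
have -> : lambda_K p K 0 \notin lambda_K p K @: [set~ 0].
  apply/imsetP => -[z]; rewrite !inE => /negPf z_nz [+ _]; by rewrite eqxx z_nz.
by rewrite (card_subspace_labels perp0) perp_eq0 perp_eqT [X in (_ + X)%N]addnC.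
Qed.

End OneSubspace.

Hypothesis n_even : ~~ odd n.
Hypothesis P_family : bent_family p n delta P.

Section FixTrace.

Variables (s' : nat) (Fr' : finFieldType) (iota' : {rmorphism Fr' -> Fr}).
Hypotheses (s'_dvd_s : (s' %| s)%N) (cardFr' : #|Fr'| = (p ^ s')%N).

Let delta' := if s' == s then delta else 1%N.

Definition trace_values : {set Fr'} := if delta' == 1%N then setT else [set~ 0].

Lemma card_trace_values : #|trace_values| = (p ^ s' - 1 + delta')%N.
Proof.
have r'_gt0 : (0 < p ^ s')%N by rewrite expn_gt0 prime_gt0.
have delta01 : (delta' == 1%N) || (delta' == 0%N).
  rewrite /delta'; case: ifP => // _.
  by have [_ [_ [_ [_ [[-> _] | [-> _]]]]]] := P_family.
rewrite /trace_values; case: eqP delta01 => /= [-> _ | _ /eqP ->].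
  by rewrite cardsT cardFr' subnK.
by rewrite cardsC1 cardFr' addn0 subn1.
Qed.

(** The set does not depend on beta, so it serves both gamma P^(0) and gamma^-1 Q^(0), where beta is
    gamma and gamma^-1 / 4. *)
Lemma trace_valuesE (beta : Fr) j : beta != 0 ->
  (exists2 x, x != 0 & tr iota' (beta * P 0 x) = j) <-> j \in trace_values.
Proof.
move=> beta_nz; have [_ [_ [_ [[_ _ _ _ P_surj] P_aniso]]]] := P_family.
have tr'0 := tr_0 p_pr iota' cardFr' cardFr s'_dvd_s.
have surj c : c != 0 -> exists2 x, x != 0 & beta * P 0 x = c.
  move=> c_nz; have [x x_nz xE] := P_surj (beta^-1 * c) (mulf_neq0 (invr_neq0 beta_nz) c_nz).
  by exists x; rewrite // xE mulVKf.
have [-> | j_nz] := eqVneq j 0; last first.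
  have -> : j \in trace_values by rewrite /trace_values; case: ifP; rewrite !inE.
  split=> // _; have [c cE] := tr_surj p_pr iota' cardFr' cardFr s'_dvd_s j.
  have c_nz : c != 0 by apply: contraNneq j_nz => c0; rewrite -cE c0 tr'0.
  by have [x x_nz xE] := surj c c_nz; exists x; rewrite // xE.
have -> : (0 \in trace_values) = (delta' == 1%N).
  by rewrite /trace_values; case: ifP; rewrite !inE ?eqxx.
rewrite /delta'; case: (s' =P s) => [ss' | /eqP s'_neq].
  have tr_inj c : tr iota' c = 0 -> c = 0.
    move=> trc; have := @trP Fr' Fr iota' 1 c; rewrite cardFr cardFr' ss' expn1 => /(_ erefl).
    by rewrite trc rmorph0 big_ord_recl big_ord0 /= expn0 expr1 addr0.
  case: P_aniso => [[-> [x x_nz xE]] | [-> aniso]]; split=> //.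
    by exists x; rewrite // xE mulr0.
  case=> x x_nz /tr_inj/eqP; rewrite mulf_eq0 (negPf beta_nz) /= => /eqP/aniso x0.
  by rewrite x0 eqxx in x_nz.
split=> // _; have s_gt0 : (0 < s)%N by have := finNzRing_gt1 Fr; rewrite cardFr; case: (s).
(* For s' < s the trace cannot be injective; c1 - c2 is then a nonzero element of trace 0, and as a
   nonzero element it is a value of beta P^(0). *)
have /injectivePn[c1 [c2 c12 trE]] : ~~ injectiveb (tr iota').
  apply/negP => /injectiveP/leq_card; rewrite cardFr cardFr' leq_exp2l ?prime_gt1 // leqNgt.
  by rewrite ltn_neqAle s'_neq dvdn_leq.
rewrite -subr_eq0 in c12 *; have [x x_nz xE] := surj (c1 - c2) c12.
by exists x; rewrite // xE (tr_additive p_pr iota' cardFr' cardFr s'_dvd_s) trE subrr.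
Qed.

Lemma trace_valuesP (beta : Fr) : beta != 0 ->
  forall j, reflect (exists2 x, x != 0 & tr iota' (beta * P 0 x) = j) (j \in trace_values).
Proof. by move=> beta_nz j; apply: (iffP idP); rewrite trace_valuesE. Qed.

Section FixLabels.

Variables (L1 L2 : finType) (kappa : Fq -> L1) (lambda : Fq -> L2).
Hypothesis labels : dual_labels p iota kappa lambda.
Variable gamma : Fr.
Hypothesis gamma_nz : gamma != 0.

Local Notation Phi := (label iota iota' kappa lambda P gamma).

Lemma family_Fourier_reflexive : Fourier_reflexive form (preim_partition Phi [set: V]).
Proof.
have [Q [e [[PQ P_dep Q_dep e_dep] [[_ Q_P P00 P_even _] _]]]] := P_family.
have [kappa_scale kappa_sums lambda_sums lambdaN lambda0] := labels.
have Q00 : Q 0 0 = 0 by rewrite Q_P P00 mulr0.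
have Q_values j :
    reflect (exists2 x, x != 0 & tr iota' (gamma^-1 * Q 0 x) = j) (j \in trace_values).
  have four_nz : 4 != 0 :> Fr by apply: (four_neq0 p_pr p_odd cardFr).
  have beta_nz : gamma^-1 * 4^-1 != 0 by rewrite mulf_neq0 ?invr_eq0.
  by apply: (iffP (trace_valuesP beta_nz j)) => -[x x_nz xE]; exists x; rewrite // -xE Q_P mulrA.
apply: (label_reflexive p_pr s_dvd_k s'_dvd_s cardFr cardFq cardFn cardFr' PQ Q_dep e_dep
  P00 Q00 gamma_nz kappa_scale kappa_sums lambda_sums lambda0 (trace_valuesP gamma_nz) Q_values).
Qed.

Lemma family_scheme d :
  (#|kappa @: [set~ (0%R : Fq)]| * p ^ s' + (p ^ s' - 1 + delta') +
    #|lambda @: [set: Fq]|)%N = d.+1 ->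
  symmetric_scheme d (relations (preim_partition Phi [set: V])).
Proof.
have [Q [e [[PQ P_dep Q_dep e_dep] [[_ Q_P P00 P_even _] _]]]] := P_family.
have [kappa_scale kappa_sums lambda_sums lambdaN lambda0] := labels.
have Q00 : Q 0 0 = 0 by rewrite Q_P P00 mulr0.
have Q_values j :
    reflect (exists2 x, x != 0 & tr iota' (gamma^-1 * Q 0 x) = j) (j \in trace_values).
  have four_nz : 4 != 0 :> Fr by apply: (four_neq0 p_pr p_odd cardFr).
  have beta_nz : gamma^-1 * 4^-1 != 0 by rewrite mulf_neq0 ?invr_eq0.
  by apply: (iffP (trace_valuesP beta_nz j)) => -[x x_nz xE]; exists x; rewrite // -xE Q_P mulrA.
have kappaN z : kappa (- z) = kappa z.
  by rewrite -mulN1r -(rmorphN1 iota) kappa_scale // oppr_eq0 oner_eq0.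
have P_even' z x : P (- z) (- x) = P z x.
  by rewrite P_even; apply: P_dep; rewrite oppr_eq0.
rewrite -card_trace_values => card_d.
exact: (label_scheme p_pr s_dvd_k s'_dvd_s cardFr cardFq cardFn cardFr' PQ Q_dep e_dep
  P00 Q00 gamma_nz kappa_scale kappa_sums lambda_sums P_even' kappaN lambdaN lambda0
  (trace_valuesP gamma_nz) Q_values card_d).
Qed.

End FixLabels.

End FixTrace.

Section Cells.

Variables (s' : nat) (Fr' : finFieldType) (iota' : {rmorphism Fr' -> Fr}) (gamma : Fr).
Hypotheses (s'_dvd_s : (s' %| s)%N) (cardFr' : #|Fr'| = (p ^ s')%N).
Variables (H' : V -> Fr') (P0' : Fn -> Fr').
Hypotheses (H'E : H' =1 trace_H iota iota' P gamma).
Hypothesis (P0'E : forall x, P0' x = tr iota' (gamma * P 0 x)).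

Lemma Omega_preim_partition (K : {set Fq}) : subspace iota K ->
  Omega H' P0' p K =
    preim_partition (label iota iota' (kappa_K K) (lambda_K p K) P gamma) [set: V].
Proof.
move=> K_sub; set Phi := label _ _ _ _ _ _.
have K0 : 0 \in K by have [] := K_sub.
have [perp perpE] : exists A, A = trace_perp p K by exists (trace_perp p K).
have perp0 : 0 \in perp by rewrite perpE; have [] := perp_subspace p_pr cardFq K_sub.
have PhiE x y z : Phi (x, y, z) =
    if z != 0 then inl (inl (false, z \in K, H' (x, y, z)))
    else if x != 0 then inl (inr (P0' x)) else inr (y == 0, y \in perp).
  rewrite /Phi /label /kappa_K /lambda_K -perpE /= -!H'E; case: (eqVneq z 0) => [-> | //] /=.
  by rewrite H'E /trace_H (H_of_z0 iota p_pr s_dvd_k cardFr cardFq) -P0'E.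
have cell0 : [set 0] = level Phi (inr (true, true)).
  apply/setP => -[[x y] z]; rewrite !inE PhiE -[0]/((0, 0), 0) !xpair_eqE.
  case: (z == 0); case: (x == 0); rewrite ?andbF //=.
  by rewrite -[RHS]/((_, _) == (_, _)) xpair_eqE; case: eqP => // ->; rewrite perp0.
have cellB1 : B1_cell Fn p K = level Phi (inr (false, true)).
  rewrite /B1_cell -perpE; apply/setP => -[[x y] z]; rewrite !inE PhiE /=.
  case: (z == 0); case: (x == 0); rewrite //=.
have cellB2 : B2_cell Fn p K = level Phi (inr (false, false)).
  rewrite /B2_cell -perpE; apply/setP => -[[x y] z]; rewrite !inE PhiE /=.
  case: (z == 0); case: (x == 0); rewrite //=.
  rewrite -[RHS]/((_, _) == (_, _)) xpair_eqE !eqbF_neg; case: (eqVneq y 0) => // ->.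
  by rewrite perp0.
have cell_e i : e_cell Fq P0' i = level Phi (inl (inr i)).
  apply/setP => -[[x y] z]; rewrite !inE PhiE /=.
  by case: (z == 0); case: (x == 0).
have cell_d i : d_cell H' K i = level Phi (inl (inl (false, true, i))).
  apply/setP => -[[x y] z]; rewrite !inE PhiE /=.
  case: (z == 0); case: (x == 0); rewrite //=;
  by rewrite -[RHS]/((_, _, _) == (_, _, _)) !xpair_eqE eqxx eqb_id.
have cell_c i : c_cell H' K i = level Phi (inl (inl (false, false, i))).
  apply/setP => -[[x y] z]; rewrite !inE PhiE /=.
  case: (eqVneq z 0) => [-> | _]; first by rewrite K0; case: (x == 0).
  by rewrite -[RHS]/((_, _, _) == (_, _, _)) !xpair_eqE eqxx eqbF_neg.
(* The labels that no point carries: z = 0 within the first stratum, and y = 0 outside the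
   orthogonal. All other labels match a cell, possibly an empty one that is removed. *)
have no_level l : level Phi l != set0 ->
    match l with inl (inl (true, _, _)) | inr (true, false) => False | _ => True end.
  case/set0Pn => -[[x y] z]; rewrite inE PhiE => /eqP <-.
  case: (z == 0); case: (x == 0) => //=.
  by case: (eqVneq y 0) => [-> | //]; rewrite perp0.
apply/setP => S; apply/idP/mem_preim_partition_level.
  rewrite in_setD1 => /andP[S_nz]; rewrite !in_setU !in_set1 => S_in; split=> //.
  move: S_in; case/orP => [/orP[/orP[/orP[/orP[]|] | /imsetP[i _]] | /imsetP[i _]] | /imsetP[i _]].
  - by move/eqP ->; exists (inr (true, true)).
  - by move/eqP ->; exists (inr (false, true)).
  - by move/eqP ->; exists (inr (false, false)).
  - by move->; exists (inl (inr i)).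
  - by move->; exists (inl (inl (false, true, i))).
  - by move->; exists (inl (inl (false, false, i))).
case=> S_nz [l S_l]; rewrite in_setD1 S_nz /=; move: (no_level l); rewrite -S_l.
move=> /(_ S_nz); rewrite !in_setU !in_set1 S_l.
case: l S_l => [[[[[] []] i] | i] | [[] []]] // _ _.
- by rewrite -cell_d imset_f ?orbT.
- by rewrite -cell_c imset_f ?orbT.
- by rewrite -cell_e imset_f ?orbT.
- by rewrite -cell0 eqxx.
- by rewrite -cellB1 eqxx ?orbT.
- by rewrite -cellB2 eqxx ?orbT.
Qed.

End Cells.

Lemma trace_H_id : trace_H iota idfun P 1 =1 H_of iota P.
Proof. by move=> v; rewrite /trace_H tr_id mul1r. Qed.

Lemma mem_punctured_line z0 z :
  (z \in line iota z0 :\ 0) = (z != 0) && (line iota z == line iota z0).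
Proof.
rewrite in_setD1; case: eqP => //= /eqP z_nz.
apply/imsetP/eqP => [[a _ zE] | /esym/line_eq[a _ ->]].
  by rewrite zE line_scale //; apply: contraNneq z_nz => a0; rewrite zE a0 rmorph0 mul0r.
by exists a.
Qed.

Lemma Omega_s_preim_partition :
  Omega_s iota (H_of iota P) (P 0) =
    preim_partition (label iota idfun (line iota) (line iota) P 1) [set: V].
Proof.
have [_ [_ [_ [[_ _ _ _ P_surj] _]]]] := P_family.
set Phi := label _ _ _ _ _ _; set H := H_of iota P.
have PhiE x y z : Phi (x, y, z) =
    if z != 0 then inl (inl (line iota z, H (x, y, z)))
    else if x != 0 then inl (inr (P 0 x)) else inr (line iota y).
  rewrite /Phi /label /= !trace_H_id; case: (eqVneq z 0) => [-> | //] /=.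
  by rewrite (H_of_z0 iota p_pr s_dvd_k cardFr cardFq).
have cell0 : [set 0] = level Phi (inr (line iota 0)).
  apply/setP => -[[x y] z]; rewrite !inE PhiE -[0]/((0, 0), 0) !xpair_eqE.
  case: (z == 0); case: (x == 0); rewrite ?andbF ?andbT //=.
  by apply/eqP/eqP => [-> | [/line0]].
have cell_B z0 : B_line_cell Fn (line iota z0) =
    if z0 == 0 then set0 else level Phi (inr (line iota z0)).
  apply/setP => -[[x y] z]; rewrite inE mem_punctured_line; case: (eqVneq z0 0) => [-> | z0_nz].
    rewrite inE /=; case: (eqVneq y 0) => [-> | y_nz]; rewrite /= ?andbF //.
    by rewrite (introF eqP (fun e => negP y_nz (introT eqP (line0 e)))) !andbF.
  rewrite inE PhiE /=; case: (z == 0); case: (x == 0); rewrite //=.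
  rewrite -[RHS]/(line iota y == line iota z0); case: (line iota y =P line iota z0) => y_z0;
    rewrite ?andbF ?andbT //.
  by apply: contraNneq z0_nz => y0; apply/eqP/(@line0 _ _ iota); rewrite -y_z0 y0.
have cell_c z0 i : z0 != 0 ->
    c_line_cell H (line iota z0) i = level Phi (inl (inl (line iota z0, i))).
  move=> z0_nz; apply/setP => -[[x y] z]; rewrite inE mem_punctured_line inE PhiE /=.
  case: (z == 0); first by case: (x == 0).
  by rewrite -[RHS]/((_, _) == (_, _)) xpair_eqE.
have cell_e i : e_cell Fq (P 0) i = level Phi (inl (inr i)).
  apply/setP => -[[x y] z]; rewrite !inE PhiE /=.
  by case: (z == 0); case: (x == 0).
apply/setP => S; apply/idP/mem_preim_partition.
  rewrite !in_setU in_set1 => /orP[/orP[/orP[/eqP -> | /imsetP[i i_ok ->]] |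
    /imset2P[L i L_line _ ->]] | /imsetP[L L_line ->]].
  - by exists (0, 0, 0); rewrite cell0 PhiE !eqxx.
  (* Cells e_i with i <> 0 are listed without a test for emptiness, so here P^(0) has to attain
     every nonzero value. *)
  - have [x x_nz xE] : exists2 x, x != 0 & P 0 x = i.
      move: i_ok; rewrite inE; case: (eqVneq i 0) => [-> /= | i_nz _]; last exact: P_surj.
      by case/set0Pn => -[[x y] z]; rewrite inE /= => /and3P[x_nz _ /eqP xE]; exists x.
    by exists (x, 0, 0); rewrite PhiE eqxx x_nz xE cell_e.
  - case/imsetP: L_line => z; rewrite inE => z_nz ->.
    have [y yE] := H_of_surj iota p_pr s_dvd_k cardFr cardFq P 0 i z_nz.
    by exists (0, y, z); rewrite PhiE z_nz [H _]yE -cell_c.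
  - case/imsetP: L_line => y; rewrite inE => y_nz ->.
    exists (0, y, 0); rewrite PhiE !eqxx /=.
    by rewrite -[X in B_line_cell _ X]/(line iota y) cell_B (negPf y_nz).
case=> -[[x y] z] ->; rewrite PhiE !in_setU in_set1.
have lineL u : u != 0 -> line iota u \in lines iota by move=> u_nz; rewrite linesE imset_f ?inE.
case: (eqVneq z 0) => [_ | z_nz] /=; last by rewrite -cell_c // imset2_f ?orbT ?lineL.
case: (eqVneq x 0) => [_ | x_nz] /=.
  case: (eqVneq y 0) => [-> | y_nz]; first by rewrite -cell0 eqxx.
  by have := cell_B y; rewrite (negPf y_nz) => <-; rewrite imset_f ?orbT ?lineL.
rewrite -cell_e imset_f ?orbT // inE; apply/orP; right; apply/set0Pn.
by exists (x, 0, 0); rewrite inE /= x_nz !eqxx.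
Qed.

(** Serves both fusions: into Omega(H, K0), with [kappa] and [lambda] unchanged, and into
    Omega_s(H), where a line determines membership in K0 and in its orthogonal. *)
Lemma label_factor (Fr' : finFieldType) (iota' : {rmorphism Fr' -> Fr})
    (L1 L2 L1' L2' : finType) (kappa : Fq -> L1) (lambda : Fq -> L2)
    (kappa' : Fq -> L1') (lambda' : Fq -> L2') (gamma : Fr) :
    (forall z z', kappa z = kappa z' -> kappa' z = kappa' z') ->
    (forall z z', lambda z = lambda z' -> lambda' z = lambda' z') ->
  forall v v' : V, label iota idfun kappa lambda P 1 v = label iota idfun kappa lambda P 1 v' ->
  label iota iota' kappa' lambda' P gamma v = label iota iota' kappa' lambda' P gamma v'.
Proof.
move=> kappa_fact lambda_fact v v'; rewrite /label !trace_H_id /trace_H.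
by case: (v.2 == 0); case: (v'.2 == 0); case: (v.1.1 == 0); case: (v'.1.1 == 0) => //= -[];
  first [by move/lambda_fact -> | by move=> -> | by move=> /kappa_fact -> ->].
Qed.

(* The two linear forms c |-> tr (gamma1 c) and c |-> tr (gamma2 c) have the same kernel. *)
Lemma label_coset (s' : nat) (Fr' : finFieldType) (iota' : {rmorphism Fr' -> Fr})
    (L1 L2 : finType) (kappa : Fq -> L1) (lambda : Fq -> L2) (gamma1 gamma2 : Fr) :
    (s' %| s)%N -> #|Fr'| = (p ^ s')%N -> gamma1 != 0 -> gamma2 != 0 ->
    preim_partition (label iota iota' kappa lambda P gamma1) [set: V] =
      preim_partition (label iota iota' kappa lambda P gamma2) [set: V] ->
  exists2 c : Fr', c != 0 & gamma1 = iota' c * gamma2.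
Proof.
move=> s'_dvd_s cardFr' g1_nz g2_nz eq_part.
have trB := tr_additive p_pr iota' cardFr' cardFr s'_dvd_s.
have trZ := tr_scale iota' cardFr' cardFr s'_dvd_s.
have same c c' : tr iota' (gamma2 * c) = tr iota' (gamma2 * c') ->
    tr iota' (gamma1 * c) = tr iota' (gamma1 * c').
  (* At z = 1 and x = 0 the function H takes all values, so two arbitrary elements c and c' can be
     compared there. *)
  have [y yE] := H_of_surj iota p_pr s_dvd_k cardFr cardFq P 0 c (oner_neq0 _).
  have [y' yE'] := H_of_surj iota p_pr s_dvd_k cardFr cardFq P 0 c' (oner_neq0 _).
  move=> trE; have := preim_partition_inj (x := (0, y, 1)) (y := (0, y', 1)) (esym eq_part).
  rewrite /label /= oner_neq0 /trace_H yE yE' trE => /(_ erefl) [] //.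
(* With Tr a0 = 1, the elements gamma2 c and Tr (gamma2 c) a0 have equal traces. Applying [same]
   yields Tr (gamma1 c) = k0 Tr (gamma2 c) for all c, and nondegeneracy of the trace form gives
   gamma1 = k0 gamma2. *)
have [a0 a0E] := tr_surj p_pr iota' cardFr' cardFr s'_dvd_s 1.
pose k0 := tr iota' (gamma1 * (gamma2^-1 * a0)).
have g1E : gamma1 = iota' k0 * gamma2.
  apply/eqP; rewrite -subr_eq0; apply/eqP/(tr1_nondegenerate p_pr cardFr) => c.
  rewrite -(tr1_tr p_pr iota' cardFr' cardFr s'_dvd_s) mulrBl trB -mulrA trZ.
  have -> : tr iota' (gamma1 * c) =
      tr iota' (gamma1 * (iota' (tr iota' (gamma2 * c)) * (gamma2^-1 * a0))).
    apply: same; rewrite [gamma2 * (iota' _ * _)]mulrCA trZ mulVKf // a0E mulr1 //.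
  by rewrite [gamma1 * (iota' _ * _)]mulrCA trZ -/k0 [k0 * _]mulrC subrr (tr1_0 p_pr cardFr').
exists k0 => //; apply: contraNneq g1_nz => k0_0.
by rewrite g1E k0_0 rmorph0 mul0r.
Qed.

End Final.

Theorem corollary6p1 (p n k s : nat) (Fr Fq Fn : finFieldType)
    (iota_q : {rmorphism Fr -> Fq}) (iota_n : {rmorphism Fr -> Fn})
    (P : Fq -> Fn -> Fr) (delta : nat)
    (p_prime : prime p) (p_odd : odd p) (s_dvd_k : (s %| k)%N)
    (card_Fr : #|Fr| = (p ^ s)%N) (card_Fq : #|Fq| = (p ^ k)%N)
    (card_Fn : #|Fn| = (p ^ n)%N)
    (choice : (choice_a p n s iota_n P /\ delta = if n == (2 * s)%N then 0%N else 1%N)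
              \/ (choice_b n s iota_n P /\ delta = 1%N)) :
  let q := (p ^ k)%N in
  let r := (p ^ s)%N in
  let form := @V_form Fn Fq p in
  let H := H_of iota_q P in
  let Omega_K0 := Omega H (P 0) p in
  (forall t : Fr, t != 0 -> non_weakly_regular form (component p H t)) /\
  vectorial_dual_bent form H /\
  symmetric_scheme ((q - 1) %/ (r - 1) * (r + 1) + (r - 1) + delta)%N
    (relations (Omega_s iota_q H (P 0))) /\
  (forall K0 : {set Fq}, subspace iota_q K0 ->
    symmetric_scheme
      (if (K0 == [set 0]) || (K0 == [set: Fq]) then (2 * r + delta)%N
       else (3 * r + 1 + delta)%N)
      (relations (Omega_K0 K0))) /\
  (forall (s' : nat) (Fr' : finFieldType) (iota' : {rmorphism Fr' -> Fr}),
    (s' %| s)%N -> #|Fr'| = (p ^ s')%N ->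
    let r' := (p ^ s')%N in
    let delta' := if s' == s then delta else 1%N in
    let H' gamma v := tr iota' (gamma * H v) in
    let P0' gamma x := tr iota' (gamma * P 0 x) in
    let Omega' gamma := Omega (H' gamma) (P0' gamma) p in
    forall K0 : {set Fq}, subspace iota_q K0 ->
    (forall gamma : Fr, gamma != 0 ->
      let d' := if (K0 == [set 0]) || (K0 == [set: Fq]) then (2 * r' + delta')%N
                else (3 * r' + 1 + delta')%N in
      [/\ Fourier_reflexive form (Omega' gamma K0),
          fusion_scheme d' (relations (Omega' gamma K0))
            (relations (Omega_K0 K0)) &
          fusion_scheme d' (relations (Omega' gamma K0))
            (relations (Omega_s iota_q H (P 0)))]) /\
    (forall gamma1 gamma2 : Fr, gamma1 != 0 -> gamma2 != 0 ->
      ~ (exists2 c : Fr', c != 0 & gamma1 = iota' c * gamma2) ->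
      Omega' gamma1 K0 <> Omega' gamma2 K0)).
Proof.
move=> q r form H Omega_K0.
have [n_even P_family] : ~~ odd n /\ bent_family p n delta P.
  case: choice => [[ch ->] | [ch ->]].
    have [m [_ [_ [_ [_ [_ [[n_eq s_dvd_m _] _]]]]]]] := ch.
    have n_even : ~~ odd n by rewrite n_eq mul2n odd_double.
    split=> //; apply: (choice_a_bent_family p_prime p_odd _ n_even card_Fr card_Fn ch).
    by rewrite n_eq dvdn_mull.
  have [_ [[n_even s_dvd_n _ _] _]] := ch.
  by split=> //; apply: (choice_b_bent_family p_prime p_odd s_dvd_n n_even card_Fr card_Fn ch).
have Omega_K0E K0 : subspace iota_q K0 -> Omega_K0 K0 =
    preim_partition (label iota_q idfun (kappa_K K0) (lambda_K p K0) P 1) [set: Fn * Fq * Fq].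
  apply: (Omega_preim_partition p_prime s_dvd_k card_Fr card_Fq) => [v | x].
    by rewrite trace_H_id.
  by rewrite tr_id mul1r.
have K0_scheme (s' : nat) (Fr' : finFieldType) (iota' : {rmorphism Fr' -> Fr}) gamma K0 :
    (s' %| s)%N -> #|Fr'| = (p ^ s')%N -> gamma != 0 -> subspace iota_q K0 ->
    let delta' := if s' == s then delta else 1%N in
    symmetric_scheme (if (K0 == [set 0]) || (K0 == [set: Fq]) then (2 * p ^ s' + delta')%N
                      else (3 * p ^ s' + 1 + delta')%N)
      (relations (preim_partition (label iota_q iota' (kappa_K K0) (lambda_K p K0) P gamma)
                    [set: Fn * Fq * Fq])).
  move=> s'_dvd_s card_Fr' gamma_nz K0_sub delta'.
  apply: (family_scheme p_prime p_odd s_dvd_k card_Fr card_Fq card_Fn P_family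
    iota' s'_dvd_s card_Fr' (subspace_dual_labels p_prime card_Fq K0_sub) gamma_nz).
  have zero_in : 0 \in K0 by have [] := K0_sub.
  (* If j of the sets K0 without 0 and the complement of K0 are nonempty, the number of cells is j
     r' + (r' - 1 + delta') + (1 + j), one more than the number of classes; j = 1 for K0 = {0} or
     F_q, and j = 2 otherwise. *)
  rewrite (card_subspace_labels zero_in) (card_lambda_labels p_prime card_Fq K0_sub) -/delta'.
  have r'_gt0 : (0 < p ^ s')%N by rewrite expn_gt0 prime_gt0.
  have neq0T : [set 0] != [set: Fq] :> {set Fq}.
    by apply/eqP => /setP/(_ 1); rewrite !inE oner_eq0.
  case: (eqVneq K0 [set 0]) => [-> | _] /=; first by rewrite neq0T; clear -r'_gt0; lia.
  by case: (eqVneq K0 [set: Fq]) => _ /=; clear -r'_gt0; lia.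
split.
  move=> t; exact: (H_non_weakly_regular iota_q p_prime p_odd s_dvd_k card_Fr card_Fq
    card_Fn n_even P_family).
split.
  exact: (H_vectorial_dual_bent iota_q p_prime p_odd s_dvd_k card_Fr card_Fq
    card_Fn n_even P_family).
split.
  rewrite (Omega_s_preim_partition iota_q p_prime s_dvd_k card_Fr card_Fq P_family).
  apply: (family_scheme p_prime p_odd s_dvd_k card_Fr card_Fq card_Fn P_family
    idfun (dvdnn s) card_Fr (line_dual_labels p iota_q) (oner_neq0 _)).
  rewrite eqxx.
  (* The additional label is the degenerate line of 0, which accounts for the cell {0}. *)
  have -> : #|line iota_q @: [set: Fq]| = (#|lines iota_q|.+1).
    rewrite -[X in line iota_q @: pred_of_set X](setUCr [set 0]) imsetU1 cardsU1 -linesE.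
    suff -> : line iota_q 0 \notin lines iota_q by [].
    by rewrite linesE; apply/imsetP => -[z]; rewrite !inE => /eqP z_nz /esym/line0.
  rewrite -linesE (card_lines iota_q) card_Fr card_Fq -/q -/r.
  by set l := (_ %/ _)%N; rewrite !mulnDr; clear; lia.
split.
  move=> K0 K0_sub; rewrite Omega_K0E //.
  have := K0_scheme s Fr idfun 1 K0 (dvdnn s) card_Fr (oner_neq0 _) K0_sub; by rewrite eqxx.
move=> s' Fr' iota' s'_dvd_s card_Fr' r' delta' H' P0' Omega' K0 K0_sub.
have Omega'E gamma : Omega' gamma K0 =
    preim_partition (label iota_q iota' (kappa_K K0) (lambda_K p K0) P gamma) [set: Fn * Fq * Fq].
  exact: (Omega_preim_partition p_prime s_dvd_k card_Fr card_Fq).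
split=> [gamma gamma_nz d' | gamma1 gamma2 g1_nz g2_nz no_c]; last first.
  rewrite !Omega'E.
  by move/(label_coset p_prime s_dvd_k card_Fr card_Fq s'_dvd_s card_Fr' g1_nz g2_nz).
have [scheme _] := K0_scheme s' Fr' iota' gamma K0 s'_dvd_s card_Fr' gamma_nz K0_sub.
rewrite Omega'E; split.
- exact: (family_Fourier_reflexive p_prime p_odd s_dvd_k card_Fr card_Fq card_Fn P_family
    iota' s'_dvd_s card_Fr' (subspace_dual_labels p_prime card_Fq K0_sub) gamma_nz).
- split=> // A A_in; rewrite Omega_K0E //; by apply: level_fusion A_in; apply: label_factor.
- split=> // A A_in.
  rewrite (Omega_s_preim_partition iota_q p_prime s_dvd_k card_Fr card_Fq P_family).
  (* Points on the same line differ by a nonzero scalar of F_r, under which K0 and its orthogonal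
     are stable. *)
  apply: level_fusion A_in; apply: label_factor => z z' /line_eq[a a_nz ->].
    by rewrite /kappa_K mulf_eq0 fmorph_eq0 (negPf a_nz) (subspaceZ K0_sub).
  rewrite /lambda_K mulf_eq0 fmorph_eq0 (negPf a_nz).
  by rewrite (subspaceZ (perp_subspace p_prime card_Fq K0_sub)).
Qed.
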